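(* Let $\mathbb{K}$ be in addition distributive, let $k\ge1$ be an integer, and let $\Phi:\mathbb{K}\to[0,\infty)$ be a function with $\Phi(\hat1)=0$. There exists a unique Radon measure $\lambda$ on $\mathcal{P}_k'=\mathcal{P}_k\setminus\{\mathbb{K}\}$ such that $\Phi(x)=\lambda(\mathcal{P}_k^x)$ for all $x\in\mathbb{K}$, where $\mathcal{P}_k^x=\{V\in\mathcal{P}_k': x\notin V\}$, if and only if $\Phi$ is a conjugate $k$-valuation.
   Context: A dcpo is a poset in which every (nonempty) directed subset has a supremum. In a dcpo, $x\ll y$ means that every directed $E$ with $y\le\sup E$ contains some $w$ with $x\le w$. A domain is a dcpo in which, for each $x$, the set $\{z: z\ll x\}$ is a directed lower set with supremum $x$. A subset $U$ is Scott open if it is an upper set and meets every directed $E$ with $\sup E\in U$. The Lawson topology has as subbase the Scott open sets together with the complements of the principal upper sets $\{z: x\le z\}$. $\mathbb{K}$ is a domain which is also a lattice with top element $\hat1$, such that $\hat1\ll\hat1$ and $\ll$ is multiplicative: $a\ll x$, $b\ll y$ imply $a\wedge b\ll x\wedge y$. $\mathcal{F}=\mathrm{OFilt}(\mathbb{K})$ is the set of Scott open filters (nonempty, down-directed Scott open sets) of $\mathbb{K}$ ordered by inclusion; it is a continuous lattice whose Lawson topology is compact Hausdorff. A Radon measure is a Borel measure, finite on compact sets, inner regular on open sets and outer regular on Borel sets. $P$ is the set of prime elements of $\mathbb{K}$: those $z\ne\hat1$ such that $\mathbb{K}\setminus\{y:y\le z\}$ is a filter or empty (equivalently $z=x\wedge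 y$ implies $z=x$ or $z=y$). For $A\subseteq\mathbb{K}$ put $\langle A\rangle=\{z: z\le a\text{ for some }a\in A\}$. $\mathcal{P}_k=\{\mathbb{K}\setminus\langle A\rangle: A\subseteq P,\ 0\le|A|\le k\}$, a compact subset of $\mathcal{F}$ (the element $\mathbb{K}$ corresponds to $A=\varnothing$); $\mathcal{P}_k'=\mathcal{P}_k\setminus\{\mathbb{K}\}$ with the subspace topology is locally compact Hausdorff. A conjugate Scott function (conjugate) is a function $\Phi:\mathbb{K}\to[0,\infty)$ with $\Phi(x)=\inf_{z\ll x}\Phi(z)$ for all $x$ (in particular decreasing, possibly unbounded), normalized by $\Phi(\hat1)=0$. Put $\nabla_z\Phi(x)=\Phi(x)-\Phi(x\wedge z)$ and $\nabla_{z_1,\ldots,z_n}\Phi=\nabla_{z_n}(\nabla_{z_1,\ldots,z_{n-1}}\Phi)$; this depends only on $A=\{z_1,\ldots,z_n\}$ and is denoted $\nabla_A\Phi$. A decreasing $\Phi$ is completely alternating if $\nabla_A\Phi\le0$ for every nonempty finite $A$. A completely alternating conjugate $\Phi$ is a conjugate $k$-valuation if for every $(k+1)$-element subset $B$ of $\mathbb{K}$, $$\nabla_B\Phi\Bigl(\bigwedge_{\{x,y\}\subseteq B}x\vee y\Bigr)=0,$$ the meet being over all pairs of distinct elements $x,y$ of $B$. *)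

(* Defs.v *)
From HB Require Import structures.
From mathcomp Require Import all_boot all_order all_algebra finmap.
From mathcomp Require Import all_classical all_reals all_analysis.

Set Implicit Arguments.
Unset Strict Implicit.
Unset Printing Implicit Defensive.

Import Order.TTheory GRing.Theory Num.Theory.

Local Open Scope classical_set_scope.

Section domain.
Context {d : Order.disp_t} {T : porderType d}.
Implicit Types (E U : set T) (x y z : T).

Definition directed E :=
  E !=set0 /\
  forall x y, E x -> E y -> exists2 z, E z & (x <= z)%O /\ (y <= z)%O.

Definition down_directed E :=
  forall x y, E x -> E y -> exists2 z, E z & (z <= x)%O /\ (z <= y)%O.

Definition upper_set U := forall x y, U x -> (x <= y)%O -> U y.

Definition lower_set U := forall x y, U y -> (x <= y)%O -> U x.

(* [supremums E] is the set of least upper bounds of [E]; it has at most one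
   element. *)
Definition way_below x y :=
  forall E s, directed E -> supremums E s -> (y <= s)%O ->
    exists2 w, E w & (x <= w)%O.

Definition scott_open U :=
  upper_set U /\
  forall E s, directed E -> supremums E s -> U s -> E `&` U !=set0.

Definition order_filter U := [/\ U !=set0, down_directed U & upper_set U].

Definition open_filter U := [/\ U !=set0, down_directed U & scott_open U].

End domain.

Definition is_dcpo {d : Order.disp_t} (T : porderType d) :=
  forall E : set T, directed E -> supremums E !=set0.

Definition is_domain {d : Order.disp_t} (T : porderType d) :=
  is_dcpo T /\
  forall x : T, let B := [set z | way_below z x] in
    [/\ directed B, lower_set B & supremums B x].

Definition way_below_multiplicative {d : Order.disp_t} (K : latticeType d) :=
  forall a b x y : K, way_below a x -> way_below b y ->
    way_below (a `&` b)%O (x `&` y)%O.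

(* An alias of [T] that carries the Lawson topology, so that the topology does
   not clash with others put on [T]. *)
Definition lawson {d : Order.disp_t} (T : porderType d) : Type := T.

Section lawson_topology.
Context {d : Order.disp_t} (T : porderType d).

HB.instance Definition _ := Order.POrder.on (lawson T).

Definition lawson_subbase : set (set (lawson T)) :=
  [set U | @scott_open d T U] `|`
  [set U | exists x : T, U = ~` [set z : T | (x <= z)%O]].

HB.instance Definition _ :=
  @isSubBaseTopological.Build (lawson T) (set (lawson T)) lawson_subbase id.

End lawson_topology.

Definition OFilt {d : Order.disp_t} (K : porderType d) : Type :=
  set_type [set U : set K | open_filter U].

Section OFilt_order.
Context {d : Order.disp_t} (K : porderType d).

HB.instance Definition _ := Choice.on (OFilt K).

Definition ofilt_set (V : OFilt K) : set K := set_val V.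

Definition ofilt_le (V W : OFilt K) : bool :=
  `[< ofilt_set V `<=` ofilt_set W >].

Fact ofilt_le_refl : reflexive ofilt_le.
Proof. by move=> V; apply/asboolP. Qed.

Fact ofilt_le_anti : antisymmetric ofilt_le.
Proof.
move=> V W /andP[/asboolP VW /asboolP WV].
by apply: val_inj; rewrite -!set_valE; apply/seteqP.
Qed.

Fact ofilt_le_trans : transitive ofilt_le.
Proof.
by move=> W V X /asboolP VW /asboolP WX; apply/asboolP; exact: subset_trans WX.
Qed.

Fact ofilt_display : Order.disp_t. Proof. exact: Order.Disp tt tt. Qed.

HB.instance Definition _ := Order.Le_isPOrder.Build ofilt_display (OFilt K)
  ofilt_le_refl ofilt_le_anti ofilt_le_trans.

End OFilt_order.

Section primes.
Context {d : Order.disp_t} {K : tPOrderType d}.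

Definition prime_elt (z : K) :=
  z <> \top%O /\
  (order_filter (~` [set y : K | (y <= z)%O]) \/
   ~` [set y : K | (y <= z)%O] = set0).

Definition down_closure (A : set K) : set K :=
  [set z | exists2 a, A a & (z <= a)%O].

Definition Pk (k : nat) : set (lawson (OFilt K)) :=
  [set V | exists A : {fset K},
    [/\ forall a, a \in A -> prime_elt a,
        (#|` A| <= k)%N &
        ofilt_set V = ~` down_closure [set` A]]].

End primes.

(* The sets K \ <A> in the definition of [Pk] are open filters, so that
   restricting to [V : OFilt K] there does not discard any of them. *)
Lemma open_filter_downC {d : Order.disp_t} (K : tLatticeType d)
    (A : {fset K}) : (forall a, a \in A -> prime_elt a) ->
  open_filter (~` down_closure [set` A]).
Proof.
move=> pA; split.
- exists \top%O => -[a /= aA]; rewrite le1x => /eqP a1.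
  by case: (pA a aA) => /(_ a1).
- move=> x y xA yA; exists (x `&` y)%O; last by rewrite leIl leIr.
  move=> [a /= aA xya]; have xa : ~ (x <= a)%O by move=> xa; apply: xA; exists a.
  have ya : ~ (y <= a)%O by move=> ya; apply: yA; exists a.
  case: (pA a aA) => _ [[_ + _]|a0].
    move=> /(_ x y xa ya)[z /= za [zx zy]]; apply: za.
    by apply: le_trans xya; rewrite lexI zx.
  by have : set0 x by rewrite -a0.
- split.
    move=> x y xA xy [a aA ya]; apply: xA; exists a => //.
    exact: le_trans ya.
  move=> E s [[e Ee] dE] [_ lubE] sA.
  have not_ub a : a \in A -> exists2 x, E x & ~ (x <= a)%O.
    move=> aA; apply: contrapT => H; apply: sA; exists a => //.
    by apply: lubE => x Ex; apply: contrapT => xa; apply: H; exists x.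
  have : {subset enum_fset A <= A} by [].
  have : forall r : seq K, {subset r <= A} ->
      exists2 x, E x & forall a, a \in r -> ~ (x <= a)%O.
    elim=> [|a r IH] rA; first by exists e.
    have [|x Ex xr] := IH; first by move=> b br; apply: rA; rewrite inE br orbT.
    have [|y Ey ya] := not_ub a; first by apply: rA; rewrite inE eqxx.
    have [z Ez [xz yz]] := dE x y Ex Ey; exists z => // b.
    rewrite inE => /orP[/eqP ->|br] zb; first exact/ya/(le_trans yz).
    exact/(xr b br)/(le_trans xz).
  move=> /[apply] -[x Ex xA]; exists x; split=> // -[a /= aA].
  exact: xA.
Qed.

(* The subspace topology is the library's topology on [set_type]. *)
Definition Pk' {d : Order.disp_t} (K : tPOrderType d) (k : nat) : Type :=
  set_type (Pk k `\` [set V : lawson (OFilt K) | ofilt_set V = setT]).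

HB.instance Definition _ {d : Order.disp_t} (K : tPOrderType d) (k : nat) :=
  Topological.on (Pk' K k).

Definition Pk_avoid {d : Order.disp_t} {K : tPOrderType d} (k : nat) (x : K) :
  set (Pk' K k) := [set V | ~ ofilt_set (set_val V) x].
Arguments Pk_avoid {d K} k x.

Section borel.
Context {R : realType} {T : topologicalType}.
Implicit Types mu : set T -> \bar R.

Definition borel : set (set T) := <<s [set U | open U] >>.

(* The measures of the library require a pointed carrier, whereas [Pk' K k] is
   empty when [K] has no prime element.  On a pointed space the two notions
   agree: see [borel_measureP].  As in the library, the values of [mu] outside
   [borel] are irrelevant. *)
Definition borel_measure mu :=
  [/\ mu set0 = 0%E,
      forall B, borel B -> (0 <= mu B)%E &
      forall F : (set T)^nat, (forall n, borel (F n)) -> trivIset setT F ->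
        mu (\bigcup_n F n) = (\sum_(0 <= n <oo) mu (F n))%E].

(* In a Hausdorff space, such as [Pk' K k], compact sets are Borel. *)
Definition radon_measure mu :=
  [/\ borel_measure mu,
      forall C, compact C -> (mu C < +oo)%E,
      forall U, open U ->
        mu U = ereal_sup [set mu C | C in [set C | compact C /\ C `<=` U]] &
      forall B, borel B ->
        mu B = ereal_inf [set mu U | U in [set U | open U /\ B `<=` U]]].

End borel.

Section borel_measureP.
Context {R : realType} {T : ptopologicalType}.
Local Open Scope ring_scope.
Local Notation Tborel := (g_sigma_algebraType [set U : set T | open U]).
Local Open Scope ereal_scope.

Let restr (mu : set T -> \bar R) (A : set Tborel) : \bar R :=
  if `[< borel A >] then mu A else 0.

Lemma borel_measureP (mu : set T -> \bar R) :
  borel_measure mu <->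
  exists nu : {measure set Tborel -> \bar R}, forall B, borel B -> nu B = mu B.
Proof.
split=> [[mu0 mu_ge0 mu_add]|[nu numu]].
  have r0 : restr mu set0 = 0 by rewrite /restr; case: ifP.
  have r_ge0 A : 0 <= restr mu A.
    by rewrite /restr; case: ifP => // /asboolP /mu_ge0.
  have rE A : borel A -> restr mu A = mu A by rewrite /restr => /asboolP ->.
  have r_add : semi_sigma_additive (restr mu).
    move=> F mF tF mUF; rewrite (rE _ mUF) mu_add//.
    under [X in _ --> X]eq_eseriesr do rewrite -(rE _ (mF _)).
    exact: is_cvg_nneseries.
  pose m := isMeasure.Build _ Tborel R (restr mu) r0 r_ge0 r_add.
  pose nu : {measure set Tborel -> \bar R} := HB.pack (restr mu) m.
  by exists nu => B /rE.
have bE B : borel B = @measurable _ Tborel B by [].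
split.
- by rewrite -numu ?measure0// bE; exact: measurable0.
- by move=> B /numu <-; exact: measure_ge0.
- move=> F bF tF; rewrite -numu; last first.
    by rewrite bE; apply: bigcupT_measurable => n; exact: bF.
  rewrite (@measure_semi_bigcup _ _ _ nu)//.
    by apply: eq_eseriesr => n _; exact: numu.
  by apply: bigcupT_measurable => n; exact: bF.
Qed.

End borel_measureP.

Section conjugate.
Context {d : Order.disp_t} {R : realType}.
Local Open Scope ring_scope.

Definition nabla {K : latticeType d} (z : K) (Phi : K -> R) : K -> R :=
  fun x => Phi x - Phi (x `&` z)%O.

(* [nablas [:: z1; ..; zn] Phi] is nabla_{z1,..,zn} Phi.  It depends only on
   the set of the entries of the sequence ([eq_nablas]); below it is applied to
   finite sets [A : {fset K}] through their coercion to sequences. *)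
Definition nablas {K : latticeType d} (s : seq K) (Phi : K -> R) : K -> R :=
  foldl (fun Psi z => nabla z Psi) Phi s.

Lemma eq_nablas {K : latticeType d} (s t : seq K) (Phi : K -> R) :
  s =i t -> nablas s Phi = nablas t Phi.
Proof.
have nablaC (x y : K) Psi : nabla x (nabla y Psi) = nabla y (nabla x Psi).
  by apply/funext => z; rewrite /nabla -!meetA (meetC x y) !opprB !addrA;
     rewrite addrAC [in RHS]addrAC -!addrA; congr (_ + _); rewrite addrCA.
have nablaK (x : K) Psi : nabla x (nabla x Psi) = nabla x Psi.
  by apply/funext => z; rewrite /nabla -meetA meetxx subrr subr0.
have nablasS (x : K) (r : seq K) Psi :
    nablas (x :: r) Psi = nablas r (nabla x Psi) by [].
have nablasC (x : K) (r : seq K) Psi :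
    nablas r (nabla x Psi) = nabla x (nablas r Psi).
  by elim: r Psi => // y r IH Psi; rewrite !nablasS nablaC IH.
have nabla_mem (x : K) (r : seq K) Psi :
    x \in r -> nabla x (nablas r Psi) = nablas r Psi.
  elim: r Psi => // y r IH Psi; rewrite inE nablasS => /orP[/eqP <-|/IH //].
  by rewrite nablasC nablaK.
have nablas_undup (r : seq K) Psi : nablas (undup r) Psi = nablas r Psi.
  elim: r Psi => // y r IH Psi.
  rewrite nablasS [undup _]/=; case: ifP => yr; last by rewrite nablasS IH.
  by rewrite IH nablasC nabla_mem.
have nablas_rem (x : K) (r : seq K) Psi : x \in r ->
    nablas r Psi = nablas (x :: rem x r) Psi.
  elim: r Psi => // y r IH Psi; rewrite inE /=; have [-> //|_] := eqVneq y x.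
  by rewrite nablasS => /IH ->; rewrite !nablasS nablaC.
have nablas_perm (r1 r2 : seq K) Psi :
    perm_eq r1 r2 -> nablas r1 Psi = nablas r2 Psi.
  elim: r1 r2 Psi => [|y r1 IH] r2 Psi pr.
    by have := perm_size pr; case: r2 {pr}.
  have yr2 : y \in r2 by rewrite -(perm_mem pr) inE eqxx.
  rewrite (nablas_rem _ _ _ yr2) !nablasS; apply: IH.
  by rewrite -(perm_cons y); apply: perm_trans pr _; exact: perm_to_rem.
move=> st; rewrite -(nablas_undup s) -(nablas_undup t); apply: nablas_perm.
by apply: uniq_perm; rewrite ?undup_uniq// => x; rewrite !mem_undup.
Qed.

Definition is_conjugate {K : tPOrderType d} (Phi : K -> R) :=
  [/\ forall x, 0 <= Phi x,
      forall x, Phi x = inf [set Phi z | z in [set z | way_below z x]] &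
      Phi \top%O = 0].

Definition completely_alternating {K : latticeType d} (Phi : K -> R) :=
  (forall x y, (x <= y)%O -> Phi y <= Phi x) /\
  forall A : {fset K}, A != fset0 -> forall x, nablas A Phi x <= 0.

Definition conjugate_valuation {K : tLatticeType d} (k : nat) (Phi : K -> R) :=
  [/\ is_conjugate Phi, completely_alternating Phi &
      forall B : {fset K}, #|` B| = k.+1 ->
        nablas B Phi
          (\meet_(x <- B) \meet_(y <- B | y != x) (x `|` y))%O = 0].

End conjugate.

(* Main.v *)
Require Import Defs.
From HB Require Import structures.
From mathcomp Require Import all_boot all_order all_algebra finmap.
From mathcomp Require Import all_classical all_reals all_analysis.

(** Write [F] for the open filters of [K] and [P^x] for those avoiding [x].

    Existence.  For a finite list of elements of [K], repeated splitting of
    [c - Phi] yields point masses on the filters [{z | p << z}], nonnegative by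
    complete alternation, whose value at [P^x] is [Phi x] up to [<<].  A limit
    along an ultrafilter of finite lists is a finitely additive [m] on the
    subsets of the [P^x] with [m (P^x) = Phi x].  An open filter [V] is not in
    [P_k] exactly when some [k+1] elements outside [V] have all their pairwise
    joins in [V]: if there is no such family, take a largest one [B], of size at
    most [k]; the sets [{x | x \/ b in V}], [b in B], are then prime filters
    with intersection [V].  Hence, by the valuation condition, points outside [P_k] have
    neighbourhoods that are [m]-null.  So
    [C |-> inf {m E | E a neighbourhood of C in F}] is a content on the compact
    subsets of [P_k'], and it induces the Radon measure.

    Uniqueness and necessity.  The value of [nabla_A Phi x] is minus the measure
    of the cell [{V | x in V, V disjoint from A}].  The cells are closed under
    intersection, and finite unions of cells separate a compact set from the
    complement of an open set containing it. *)

Set Implicit Arguments.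
Unset Strict Implicit.
Unset Printing Implicit Defensive.

Import Order.TTheory GRing.Theory Num.Theory.
Import numFieldNormedType.Exports.

Local Open Scope classical_set_scope.

(** * Radon measures from contents *)

Section compactness.
Context {T : topologicalType}.
Implicit Types (A B C : set T) (P : set T -> Prop).

(** Stands in for finite subcovers. If no [W] worked, the sets [C] minus the interior of [W] would
    form a base of a proper filter on [C], and a cluster point of it has a neighbourhood satisfying
    [P], a contradiction. *)
Lemma compact_cover_ind P C : compact C -> P set0 ->
    (forall A B, P A -> P B -> P (A `|` B)) ->
    (forall x, C x -> exists2 W, P W & nbhs x W) ->
  exists2 W, P W & C `<=` W°.
Proof.
move=> cC P0 PU Pn; apply: contrapT => H.
pose F := filter_from P (fun W => C `\` W°).
have FF : ProperFilter F.
  apply: filter_from_proper; last first.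
    move=> W PW; apply: contrapT => CW0; apply: H; exists W => // x Cx.
    by apply: contrapT => nWx; apply: CW0; exists x.
  apply: filter_from_filter; first by exists set0.
  move=> V W PV PW; exists (V `|` W); first exact: PU.
  by move=> x [Cx nVW]; split; split=> //; apply: contra_not nVW;
     apply: filterS => y; [left|right].
have FC : F C by exists set0 => // x [].
have [x [Cx Fx]] := cC F FF FC.
have [W PW xW] := Pn x Cx.
have FW : F (C `\` W°) by exists W.
by have [y [[_ +] +]] := Fx _ _ FW (nbhs_interior xW).
Qed.

Lemma hausdorff_separate (hT : hausdorff_space T) (x y : T) : x <> y ->
  exists A B, [/\ nbhs x A, nbhs y B & A `&` B = set0].
Proof.
move=> xy; apply: contrapT => H; apply/xy/hT => A B xA yB.
by apply: contrapT => /set0P/negP; rewrite negbK => /eqP AB0; apply: H; exists A, B.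
Qed.

Lemma compact_separate (hT : hausdorff_space T) C D :
    compact C -> compact D -> C `&` D = set0 ->
  exists A B, [/\ open A, open B, C `<=` A, D `<=` B & A `&` B = set0].
Proof.
move=> cC cD CD0.
(* [P E W] says that [W] misses some neighbourhood of [E]. Cover induction runs on [C] with [E = D],
   and inside it on [D] with [E] a single point. *)
pose P (E W : set T) := exists2 V : set T, E `<=` V° & V `&` W = set0.
have PU E A B : P E A -> P E B -> P E (A `|` B).
  move=> [V EV VA] [V' EV' VB]; exists (V `&` V').
    by move=> x Ex; apply: filterI; [exact: EV|exact: EV'].
  apply/seteqP; split=> // x [[Vx V'x] [Ax|Bx]]; first by rewrite -VA.
  by rewrite -VB.
have P0 E : P E set0.
  by exists setT; [move=> x _; exact: filterT|rewrite setI0].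
have [W [V DV VW0] CW] : exists2 W, P D W & C `<=` W°.
  apply: (compact_cover_ind cC (P0 D) (PU D)) => x Cx.
  have [W [V xV VW] DW] : exists2 W, P [set x] W & D `<=` W°.
    apply: (compact_cover_ind cD (P0 [set x]) (PU [set x])) => y Dy.
    have xy : x <> y.
      by move=> xy; have : set0 x by rewrite -CD0; split=> //; rewrite xy.
    have [A [B [xA yB AB0]]] := hausdorff_separate hT xy.
    by exists B => //; exists A => // _ ->.
  exists V; last exact: xV.
  by exists W => //; rewrite setIC.
exists W°, V°; split=> //; [exact: open_interior|exact: open_interior|].
apply/seteqP; split=> // x [/interior_subset Wx /interior_subset Vx].
by rewrite -VW0.
Qed.

(** The parts of [C] outside [U] and outside [V] are disjoint compact sets; removing disjoint open
    neighbourhoods of them from [C] leaves the two pieces. *)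
Lemma compact_setU_split (hT : hausdorff_space T) C U V :
    compact C -> open U -> open V -> C `<=` U `|` V ->
  exists A B, [/\ compact A, compact B, A `<=` U, B `<=` V & C = A `|` B].
Proof.
move=> cC oU oV CUV.
have cD W : open W -> compact (C `\` W).
  move=> oW; apply: (@subclosed_compact _ _ C) => //.
  by apply: closedI; [exact: compact_closed|exact: open_closedC].
have [|A [B [oA oB CA CB AB0]]] := compact_separate hT (cD _ oU) (cD _ oV).
  apply/seteqP; split=> // x [[Cx nU] [_ nV]].
  by case: (CUV x Cx).
exists (C `\` A), (C `\` B); split; [exact: cD|exact: cD| | |].
- by move=> x [Cx nA]; apply: contrapT => nU; apply: nA; apply: CA.
- by move=> x [Cx nB]; apply: contrapT => nV; apply: nB; apply: CB.
- apply/seteqP; split=> [x Cx|x [[]|[]]//].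
  have [Ax|nA] := pselect (A x); last by left.
  by right; split=> // Bx; have : set0 x by rewrite -AB0.
Qed.

End compactness.

(** * Extension of a content to a Radon measure *)

Section content.
Context {R : realType} {T : topologicalType} (hT : hausdorff_space T).
Variable kappa : set T -> \bar R.
Local Open Scope ereal_scope.
Implicit Types (C D U V A B : set T).
Hypothesis kappa0 : kappa set0 = 0.
Hypothesis kappa_le : forall C D, compact C -> compact D -> C `<=` D ->
  kappa C <= kappa D.
Hypothesis kappaU : forall C D, compact C -> compact D ->
  kappa (C `|` D) <= kappa C + kappa D.
Hypothesis kappa_disjoint : forall C D, compact C -> compact D ->
  C `&` D = set0 -> kappa C + kappa D <= kappa (C `|` D).

Definition inner_content U :=
  ereal_sup [set kappa C | C in [set C | compact C /\ C `<=` U]].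

Definition outer_content A :=
  ereal_inf [set inner_content U | U in [set U | open U /\ A `<=` U]].

Let kappa_ge0 C : compact C -> 0 <= kappa C.
Proof. by move=> cC; rewrite -kappa0; apply: kappa_le => //; exact: compact0. Qed.

Lemma inner_content_ge U C : compact C -> C `<=` U -> kappa C <= inner_content U.
Proof. by move=> cC CU; apply: ereal_sup_ubound; exists C. Qed.

Lemma inner_content_ge0 U : 0 <= inner_content U.
Proof. by rewrite -kappa0; apply: inner_content_ge => //; exact: compact0. Qed.

Lemma le_inner_content U V : U `<=` V -> inner_content U <= inner_content V.
Proof.
move=> UV; apply: ge_ereal_sup => _ [C [cC CU] <-].
by apply: inner_content_ge => //; exact: subset_trans UV.
Qed.

Lemma inner_contentU U V : open U -> open V ->
  inner_content (U `|` V) <= inner_content U + inner_content V.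
Proof.
move=> oU oV; apply: ge_ereal_sup => _ [C [cC CUV] <-].
have [A [B [cA cB AU BV ->]]] := compact_setU_split hT cC oU oV CUV.
by apply: le_trans (kappaU cA cB) _; apply: leeD; exact: inner_content_ge.
Qed.

Lemma inner_content_bigcup (U : (set T)^nat) : (forall n, open (U n)) ->
  inner_content (\bigcup_n U n) <= \sum_(0 <= n <oo) inner_content (U n).
Proof.
move=> oU; apply: ge_ereal_sup => _ [C [cC CU] <-].
have [W [N WN] CW] : exists2 W,
    (exists N, W `<=` \big[setU/set0]_(n < N) U n) & C `<=` W°.
  apply: (compact_cover_ind (P := fun W => exists N,
      W `<=` \big[setU/set0]_(n < N) U n)) => //.
  - by exists 0%N => x.
  - move=> A B [N AN] [M BM]; exists (N + M)%N => x [/AN|/BM].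
      by apply: subset_bigsetU; rewrite leq_addr.
    by apply: subset_bigsetU; rewrite leq_addl.
  - move=> x /CU [n _ Unx]; exists (U n).
      by exists n.+1; rewrite big_ord_recr /=; right.
    exact: open_nbhs_nbhs.
apply: (@le_trans _ _ (\sum_(0 <= n < N) inner_content (U n))); last first.
  by apply: nneseries_lim_ge => n _ _; exact: inner_content_ge0.
have {}CW : C `<=` \big[setU/set0]_(n < N) U n.
  by move=> x /CW /interior_subset /WN.
apply: (le_trans (inner_content_ge cC CW)).
rewrite big_mkord; elim: N {WN CW} => [|N IH].
  rewrite !big_ord0; apply: ge_ereal_sup => _ [D [_ D0] <-].
  by rewrite (_ : D = set0) ?kappa0//; apply/seteqP; split.
rewrite !big_ord_recr /=; apply: le_trans (inner_contentU _ (oU N)) _.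
  by elim/big_ind: _ => // [|A B]; [exact: open0|exact: openU].
exact: leeD2r.
Qed.

Lemma outer_content_open U : open U -> outer_content U = inner_content U.
Proof.
move=> oU; apply/eqP; rewrite eq_le; apply/andP; split.
  by apply: ereal_inf_lbound; exists U => //; split.
by apply: le_ereal_inf_tmp => _ [V [oV UV] <-]; exact: le_inner_content.
Qed.

Lemma outer_content_ge0 A : 0 <= outer_content A.
Proof. by apply: le_ereal_inf_tmp => _ [U _ <-]; exact: inner_content_ge0. Qed.

Lemma le_outer_content A B : A `<=` B -> outer_content A <= outer_content B.
Proof.
move=> AB; apply: ereal_inf_le_tmp => _ [U [oU BU] <-].
by exists U => //; split=> //; exact: subset_trans BU.
Qed.

Lemma outer_content0 : outer_content set0 = 0.
Proof.
rewrite outer_content_open; last exact: open0.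
apply/eqP; rewrite eq_le inner_content_ge0 andbT.
apply: ge_ereal_sup => _ [D [_ D0] <-].
by rewrite (_ : D = set0) ?kappa0//; apply/seteqP; split.
Qed.

Lemma outer_content_sigma_subadditive : sigma_subadditive outer_content.
Proof.
move=> A; have [[i ioo]|] := pselect (exists i, outer_content (A i) = +oo).
  rewrite (eseries_pinfty _ _ ioo) ?leey// => n _.
  by rewrite -ltNye (lt_le_trans _ (outer_content_ge0 _)).
rewrite -forallNE => Aoo.
apply/lee_addgt0Pr => e e0.
rewrite (le_trans _ (epsilon_trick _ _ (ltW e0)))//; last first.
  by move=> n; exact: outer_content_ge0.
pose P n U := [/\ open U, A n `<=` U &
  inner_content U <= outer_content (A n) + (e / (2 ^ n.+1)%:R)%:E].
have [G PG] : {G : (set T)^nat & forall n, P n (G n)}.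
  apply: (@choice _ _ P) => n; rewrite /P /outer_content.
  have en1 : (0 < e / (2 ^ n.+1)%:R)%R by rewrite divr_gt0// ltr0n expn_gt0.
  have fin : outer_content (A n) \is a fin_num.
    by rewrite ge0_fin_numE ?outer_content_ge0// ltey; exact/eqP.
  have [x [U [oU AU] <-] /ltW xS] := lb_ereal_inf_adherent en1 fin.
  by exists U.
apply: (@le_trans _ _ (outer_content (\bigcup_n G n))).
  by apply: le_outer_content; apply: subset_bigcup => n _; have [] := PG n.
rewrite outer_content_open; last by apply: bigcup_open => n _; have [] := PG n.
apply: le_trans (inner_content_bigcup _) _; first by move=> n; have [] := PG n.
by apply: lee_nneseries => [n _ _|n _]; [exact: inner_content_ge0|have [] := PG n].
Qed.

Let m := isOuterMeasure.Build R T outer_content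
  outer_content0 outer_content_ge0 le_outer_content
  outer_content_sigma_subadditive.

Let mu : outer_measure R T := HB.pack outer_content m.

(** Equality may fail, as [kappa] is not assumed to be outer regular on compact sets. The inequality
    suffices for inner regularity of the measure on open sets. *)
Lemma outer_content_ge C : compact C -> kappa C <= outer_content C.
Proof.
move=> cC; apply: le_ereal_inf_tmp => _ [U [oU CU] <-].
exact: inner_content_ge.
Qed.

(** The test set is replaced by an open [V] containing it. For [C] compact in both [V] and [U], and
    [D] compact in [V] minus [C], [kappa_disjoint] bounds [kappa C + kappa D] by the inner content
    of [V]. The supremum over [D] and then over [C] gives the splitting, since [V] minus [U] lies in
    [V] minus [C]. *)
Lemma open_caratheodory U : open U -> mu.-caratheodory U.
Proof.
move=> oU; apply: le_caratheodory_measurable => X.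
apply: le_ereal_inf_tmp => _ [V [oV XV] <-].
apply: (@le_trans _ _ (inner_content (V `&` U) + outer_content (V `\` U))).
  rewrite -outer_content_open; last exact: openI.
  by apply: leeD; apply: le_outer_content => x [/XV].
have [->|Vfin] := eqVneq (inner_content V) +oo; first exact: leey.
have finV : inner_content V \is a fin_num.
  by rewrite ge0_fin_numE ?inner_content_ge0// ltey.
have finD : outer_content (V `\` U) \is a fin_num.
  rewrite ge0_fin_numE ?outer_content_ge0// (@le_lt_trans _ _ (inner_content V)) ?ltey//.
  by rewrite -outer_content_open//; apply: le_outer_content => x [].
rewrite -leeBrDr//; apply: ge_ereal_sup => _ [C [cC CVU] <-].
rewrite leeBrDr// -leeBrDl; last first.
  rewrite ge0_fin_numE ?kappa_ge0// (@le_lt_trans _ _ (inner_content V)) ?ltey//.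
  by apply: inner_content_ge => // x /CVU[].
have oVC : open (V `\` C).
  by apply: openI => //; apply: closed_openC; exact: compact_closed.
apply: (@le_trans _ _ (outer_content (V `\` C))).
  by apply: le_outer_content => x [Vx nU]; split=> // /CVU[].
rewrite outer_content_open//; apply: ge_ereal_sup => _ [D [cD DVC] <-].
rewrite leeBrDl; last first.
  rewrite ge0_fin_numE ?kappa_ge0// (@le_lt_trans _ _ (inner_content V)) ?ltey//.
  by apply: inner_content_ge => // x /CVU[].
apply: le_trans (kappa_disjoint cC cD _) _.
  by apply/seteqP; split=> // x [Cx /DVC[_ /(_ Cx)]].
apply: inner_content_ge; first exact: compactU.
by move=> x [/CVU[]|/DVC[]].
Qed.

Lemma borel_caratheodory B : borel B -> mu.-caratheodory B.
Proof.
apply: smallest_sub => [|U oU]; last exact: open_caratheodory.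
split.
- exact: caratheodory_measurable_set0.
- by move=> A; rewrite setTD; exact: caratheodory_measurable_setC.
- by move=> A mA; exact: caratheodory_measurable_bigcup.
Qed.

Lemma outer_content_radon :
    (forall x : T, exists2 D : set T, compact D & nbhs x D) ->
    (forall C, compact C -> kappa C < +oo) ->
  radon_measure outer_content.
Proof.
move=> lcT kfin; split.
- split=> [|B _|F bF tF]; first exact: outer_content0.
    exact: outer_content_ge0.
  have mF n : mu.-caratheodory (F n) by apply: borel_caratheodory.
  apply/eqP; rewrite eq_le; apply/andP; split.
    exact: (outer_measure_sigma_subadditive mu).
  (* Countable superadditivity is the Caratheodory inequality tested on the union itself. *)
  have := caratheodory_lime_le mF tF (\bigcup_n F n).
  rewrite setICr outer_measure0 adde0; apply: le_trans.
  apply: lee_nneseries => [n _ _|n _]; first exact: outer_content_ge0.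
  by apply: le_outer_content => x Fx; split=> //; exists n.
(* Local compactness puts [C] in the interior of a compact [D], and [kappa D] bounds its measure. *)
- move=> C cC; have [D cD CD] : exists2 D : set T, compact D & C `<=` D°.
    apply: compact_cover_ind => //; first exact: compact0.
    by move=> A B; exact: compactU.
  apply: (@le_lt_trans _ _ (kappa D)); last exact: kfin.
  apply: le_trans (le_outer_content CD) _.
  rewrite outer_content_open; last exact: open_interior.
  apply: ge_ereal_sup => _ [E [cE ED] <-]; apply: kappa_le => //.
  exact: subset_trans (@interior_subset _ _).
- move=> U oU; apply/eqP; rewrite eq_le; apply/andP; split.
    rewrite outer_content_open//; apply: ge_ereal_sup => _ [C [cC CU] <-].
    apply: le_trans (outer_content_ge cC) _.
    by apply: ereal_sup_ubound; exists C.
  by apply: ge_ereal_sup => _ [C [cC CU] <-]; exact: le_outer_content.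
- move=> B bB; congr ereal_inf; apply/seteqP; split=> _ [U [oU BU] <-].
    by exists U => //; rewrite outer_content_open.
  by exists U => //; rewrite outer_content_open.
Qed.

End content.

(** * Open filters and the Lawson topology *)

Section way_below.
Context {d : Order.disp_t} {T : porderType d}.
Implicit Types (a b x y : T).

Lemma way_below_le x y : way_below x y -> (x <= y)%O.
Proof.
move=> /(_ [set y] y)[||//|_ -> //].
  by split=> [|_ _ -> ->]; exists y.
by split=> [_ -> //|u]; apply.
Qed.

Lemma way_below_trans a x y b :
  (a <= x)%O -> way_below x y -> (y <= b)%O -> way_below a b.
Proof.
move=> ax xy yb E s dE sE bs.
by have [w Ew xw] := xy E s dE sE (le_trans yb bs); exists w => //; exact: le_trans xw.
Qed.

Context (domT : is_domain T).

(** The elements way below some [z] way below [y] form a directed set with supremum [y]; the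
    definition of [way_below x y] is applied to it. *)
Lemma way_below_interpolation x y : way_below x y ->
  exists2 z, way_below x z & way_below z y.
Proof.
move=> xy; have [_ dom] := domT.
pose E := [set w | exists2 z, way_below w z & way_below z y].
have dE : directed E.
  split.
    have [[[z zy] _] _ _] := dom y; have [[[w wz] _] _ _] := dom z.
    by exists w, z.
  move=> v w [v' vv' v'y] [w' ww' w'y].
  have [[_ /(_ _ _ v'y w'y)[z zy [v'z w'z]]] _ _] := dom y.
  have [[_ dz] _ _] := dom z.
  have [u uz vwu] := dz v w (way_below_trans (lexx v) vv' v'z)
    (way_below_trans (lexx w) ww' w'z).
  by exists u => //; exists z.
have sE : supremums E y.
  split=> [w [z /way_below_le wz /way_below_le]|u uE]; first exact: le_trans.
  have [_ _ [_ lub]] := dom y; apply: lub => z zy.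
  have [_ _ [_ lubz]] := dom z; apply: lubz => w wz.
  by apply: uE; exists z.
have [w [z wz zy] xw] := xy E y dE sE (lexx y).
by exists z => //; apply: way_below_trans wz (lexx z).
Qed.

Lemma scott_open_way_below (V : set T) x : scott_open V -> V x ->
  exists2 a, way_below a x & V a.
Proof.
move=> [_ oV] Vx; have [_ dom] := domT; have [dB _ sB] := dom x.
by have [a [ax Va]] := oV _ _ dB sB Vx; exists a.
Qed.

End way_below.

Lemma scott_open_join {d : Order.disp_t} {L : latticeType d} (V : set L) (x y : L) :
    is_domain L -> scott_open V -> V (x `|` y)%O ->
  exists a b, [/\ way_below a x, way_below b y & V (a `|` b)%O].
Proof.
move=> [_ dom] [_ oV] Vxy.
pose E := [set w | exists a b, [/\ way_below a x, way_below b y & w = (a `|` b)%O]].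
have [[[a ax] dx] _ [ubx lubx]] := dom x; have [[[b bY] dy] _ [uby luby]] := dom y.
have dE : directed E.
  split; first by exists (a `|` b)%O, a, b.
  move=> _ _ [a1 [b1 [a1x b1y ->]]] [a2 [b2 [a2x b2y ->]]].
  have [a3 a3x [a13 a23]] := dx _ _ a1x a2x.
  have [b3 b3y [b13 b23]] := dy _ _ b1y b2y.
  exists (a3 `|` b3)%O; first by exists a3, b3.
  by split; apply: leU2.
have sE : supremums E (x `|` y)%O.
  split=> [_ [a1 [b1 [a1x b1y ->]]]|u uE].
    by apply: leU2; exact: way_below_le.
  rewrite leUx; apply/andP; split.
    apply: lubx => a1 a1x; apply: le_trans (uE (a1 `|` b)%O _); first exact: leUl.
    by exists a1, b.
  apply: luby => b1 b1y; apply: le_trans (uE (a `|` b1)%O _); first exact: leUr.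
  by exists a, b1.
by have [_ [[a1 [b1 [a1x b1y ->]]] Vab]] := oV _ _ dE sE Vxy; exists a1, b1.
Qed.

Section open_filters.
Context {d : Order.disp_t} {K : tLatticeType d}.
Local Notation F := (lawson (OFilt K)).
Implicit Types (a b x y : K) (V W : F) (A : seq K).

Lemma ofiltP (V : OFilt K) : open_filter (ofilt_set V).
Proof. exact: set_valP V. Qed.

Definition to_ofilt (U : set K) (oU : open_filter U) : OFilt K :=
  exist (fun U => U \in [set U : set K | open_filter U]) U
    (@mem_set _ [set U : set K | open_filter U] U oU).

Lemma ofilt_inj V W : ofilt_set V = ofilt_set W -> V = W.
Proof. by move=> VW; apply: val_inj; rewrite -!set_valE. Qed.

Lemma ofilt_up V x y : ofilt_set V x -> (x <= y)%O -> ofilt_set V y.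
Proof. by have [_ _ [up _]] := ofiltP V; exact: up. Qed.

Lemma ofilt_meet V x y :
  ofilt_set V (x `&` y)%O <-> ofilt_set V x /\ ofilt_set V y.
Proof.
split=> [Vxy|[Vx Vy]]; first by split; apply: ofilt_up Vxy _; rewrite ?leIl ?leIr.
have [_ dV _] := ofiltP V; have [z Vz [zx zy]] := dV x y Vx Vy.
by apply: ofilt_up Vz _; rewrite lexI zx.
Qed.

Lemma ofilt_top V : ofilt_set V \top%O.
Proof. by have [[x Vx] _ _] := ofiltP V; apply: ofilt_up Vx (lex1 x). Qed.

Definition cell x A : set F :=
  [set V | ofilt_set V x /\ forall a, a \in A -> ~ ofilt_set V a].

Lemma cellI x A y B : cell x A `&` cell y B = cell (x `&` y)%O (A ++ B).
Proof.
apply/seteqP; split=> V.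
  move=> [[Vx VA] [Vy VB]]; split; first by apply/ofilt_meet.
  by move=> a; rewrite mem_cat => /orP[/VA|/VB].
move=> [/ofilt_meet[Vx Vy] VAB]; split; split=> // a aA; apply: VAB.
  by rewrite mem_cat aA.
by rewrite mem_cat aA orbT.
Qed.

Context (domK : is_domain K) (top_way_below : way_below (\top%O : K) \top%O)
  (wbM : way_below_multiplicative K).

Definition up a : set K := [set z | way_below a z].

(** Membership of the top comes from [top_way_below], directedness from multiplicativity, Scott
    openness from interpolation. *)
Lemma open_filter_up a : open_filter (up a).
Proof.
split.
- by exists \top%O; apply: way_below_trans (lex1 a) top_way_below (lexx _).
- move=> x y ax ay; exists (x `&` y)%O; last by rewrite leIl leIr.
  by rewrite /up /= -(meetxx a); exact: wbM.
- split=> [x y ax|E s dE sE as_]; first exact: way_below_trans.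
  have [b ab bs] := way_below_interpolation domK as_.
  have [w Ew bw] := bs E s dE sE (lexx s).
  by exists w; split=> //; apply: way_below_trans ab bw.
Qed.

Definition up_ofilt a : F := to_ofilt (open_filter_up a).

Lemma up_ofiltE a : ofilt_set (up_ofilt a) = up a. Proof. by []. Qed.

Lemma ofilt_way_below V x : ofilt_set V x -> exists2 a, way_below a x & ofilt_set V a.
Proof. by have [_ _ oV] := ofiltP V; exact: scott_open_way_below. Qed.

(** A directed union of open filters is again an open filter, hence is the least upper bound. *)
Lemma supremums_ofilt (E : set (OFilt K)) S : directed E -> supremums E S ->
  ofilt_set S = \bigcup_(V in E) ofilt_set V.
Proof.
move=> [[V0 EV0] dE] [ubS lubS].
have of_U : open_filter (\bigcup_(V in E) ofilt_set V).
  split.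
  - by exists \top%O, V0 => //; exact: ofilt_top.
  - move=> x y [V EV Vx] [W EW Wy].
    have [X EX [/asboolP VX /asboolP WX]] := dE V W EV EW.
    exists (x `&` y)%O; last by rewrite leIl leIr.
    by exists X => //; apply/ofilt_meet; split; [exact: VX|exact: WX].
  - split=> [x y [V EV Vx] xy|D s dD sD [V EV Vs]].
      by exists V => //; exact: ofilt_up xy.
    have [_ _ [_ oV]] := ofiltP V; have [w [Dw Vw]] := oV D s dD sD Vs.
    by exists w; split=> //; exists V.
pose U : OFilt K := to_ofilt of_U.
have /asboolP SU : (S <= U)%O.
  by apply: lubS => V EV; apply/asboolP => x Vx; exists V.
apply/seteqP; split=> [x /SU //|x [V /ubS/asboolP VS Vx]]; exact: VS.
Qed.

Lemma open_mem x : open [set V : F | ofilt_set V x].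
Proof.
suff : @lawson_subbase _ (OFilt K) [set V | ofilt_set V x].
  move=> sb; exists [set [set V : F | ofilt_set V x]]; last by rewrite bigcup_set1.
  move=> _ ->; exists [fset [set V : F | ofilt_set V x]]%fset.
    by move=> D /fset1P ->; exact: mem_set.
  by rewrite set_fset1 bigcap_set1.
left; split=> [V W Vx /asboolP|E S dE sE /=]; first exact.
by rewrite (supremums_ofilt dE sE) => -[V EV Vx]; exists V.
Qed.

Lemma open_not_up a : open [set V : F | ~ up a `<=` ofilt_set V].
Proof.
pose C := [set V : F | ~ up a `<=` ofilt_set V].
suff : @lawson_subbase _ (OFilt K) C.
  move=> sb; exists [set C]; last by rewrite bigcup_set1.
  move=> _ ->; exists [fset C]%fset; last by rewrite set_fset1 bigcap_set1.
  by move=> D /fset1P ->; exact: mem_set.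
right; exists (up_ofilt a); apply/seteqP; split=> V /=.
  by apply: contra_not => /asboolP.
by apply: contra_not => aV; apply/asboolP.
Qed.

(* Equivalently, [~ up a `<=` ofilt_set V] for every [a] in [A]; unlike
   avoiding [A], this is an open condition on [V]. *)
Definition away (A : seq K) V :=
  forall a, a \in A -> exists2 y, ~ ofilt_set V y & way_below a y.

Lemma nbhs_not_mem V a y : ~ ofilt_set V y -> way_below a y ->
  nbhs V [set W : F | ~ ofilt_set W a].
Proof.
move=> nVy ay; have VU : [set V : F | ~ up a `<=` ofilt_set V] V.
  by move=> aV; apply: nVy; exact: aV.
apply: filterS (open_nbhs_nbhs (conj (open_not_up a) VU)) => W /=.
apply: contra_not => Wa z /way_below_le; exact: ofilt_up Wa.
Qed.

Lemma nbhs_cell V x A : ofilt_set V x -> away A V -> nbhs V (cell x A).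
Proof.
move=> Vx; elim: A => [_|a A IH VA].
  by apply: filterS (open_nbhs_nbhs (conj (open_mem x) Vx)).
have [|y nVy ay] := VA a; first by rewrite mem_head.
have VA' : away A V by move=> b bA; apply: VA; rewrite inE bA orbT.
apply: filterS (filterI (IH VA') (nbhs_not_mem nVy ay)) => W [[Wx WA] Wa].
by split=> // b; rewrite inE => /orP[/eqP ->|/WA].
Qed.

Lemma nbhs_cellP V (U : set F) : nbhs V U <->
  exists x A, [/\ ofilt_set V x, away A V & cell x A `<=` U].
Proof.
split; last first.
  by move=> [x [A [Vx VA]]] /filterS; apply; exact: nbhs_cell.
rewrite nbhsE => -[G [[E EfinI <-] [B EB BV]] GU].
have [D' D'sub DB] := EfinI B EB.
suff [x [A [Vx VA xAB]]] : exists x A, [/\ ofilt_set V x, away A V & cell x A `<=` B].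
  by exists x, A; split=> // W /xAB BW; apply: GU; exists B.
have subB D : @lawson_subbase _ (OFilt K) D -> D V ->
    exists x A, [/\ ofilt_set V x, away A V & cell x A `<=` D].
  case=> [[upD oD] DV|[W -> nWV]].
    (* [V] is the directed supremum of the [up_ofilt a] with [a] in [V]. A Scott open [D] around [V]
       thus contains some [up_ofilt x], and with it every filter containing [x]. *)
    pose E' := [set (up_ofilt a : OFilt K) | a in ofilt_set V].
    have dE : directed E'.
      split; first by exists (up_ofilt \top%O), \top%O => //; exact: ofilt_top.
      move=> _ _ [a Va <-] [b Vb <-].
      exists (up_ofilt (a `&` b)%O).
        by exists (a `&` b)%O => //; apply/ofilt_meet.
      split; apply/asboolP => z az; apply: way_below_trans az (lexx z).
        exact: leIl.
      exact: leIr.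
    have sE : supremums E' V.
      split=> [_ [a Va <-]|W ubW].
        apply/asboolP => z /way_below_le; exact: ofilt_up.
      apply/asboolP => x /ofilt_way_below[a ax Va].
      by have /asboolP := ubW (up_ofilt a) (ex_intro2 _ _ a Va erefl); apply.
    have [_ [[x Vx <-] Dx]] := oD _ _ dE sE DV.
    exists x, [::]; split=> // W [Wx _].
    by apply: upD Dx _; apply/asboolP => z /way_below_le; exact: ofilt_up.
  (* An element of [W] outside [V] is lowered to some [a] way below it and still in [W], so that
     avoiding [a] is a neighbourhood condition at [V]. *)
  have [w Ww nVw] : exists2 w, ofilt_set W w & ~ ofilt_set V w.
    apply: contrapT => H; apply: nWV; apply/asboolP => w Ww.
    by apply: contrapT => nVw; apply: H; exists w.
  have [a aw Wa] := ofilt_way_below Ww.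
  exists \top%O, [:: a]; split; first exact: ofilt_top.
    by move=> b; rewrite inE => /eqP ->; exists w.
  move=> W' [_ /(_ a)]; rewrite mem_head => /(_ erefl) nW'a /asboolP WW'.
  by apply: nW'a; exact: WW'.
suff : forall r : seq (set F), (forall D, D \in r -> D \in D') ->
    exists x A, [/\ ofilt_set V x, away A V &
      forall W, cell x A W -> forall D, D \in r -> D W].
  move=> /(_ (enum_fset D') (fun _ => id))[x [A [Vx VA xA]]].
  by exists x, A; split=> // W /xA WD; rewrite -DB => D; exact: WD.
elim=> [_|D r IH rD'].
  by exists \top%O, [::]; split=> //; exact: ofilt_top.
have [x [A [Vx VA xA]]] : exists x A, [/\ ofilt_set V x, away A V & cell x A `<=` D].
  apply: subB; first by apply/set_mem/D'sub/rD'; rewrite mem_head.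
  by move: BV; rewrite -DB; apply; apply: rD'; rewrite mem_head.
have [|y [B' [Vy VB yB]]] := IH.
  by move=> D1 Dr; apply: rD'; rewrite inE Dr orbT.
exists (x `&` y)%O, (A ++ B'); split; first exact/ofilt_meet.
  by move=> a; rewrite mem_cat => /orP[/VA|/VB].
move=> W; rewrite -cellI => -[/xA DW /yB rW] D1.
by rewrite inE => /orP[/eqP ->|/rW].
Qed.

Lemma lawson_hausdorff : hausdorff_space F.
Proof.
have sep (V W : F) x : ofilt_set V x -> ~ ofilt_set W x ->
    exists A B : set F, [/\ nbhs V A, nbhs W B & A `&` B = set0].
  move=> Vx nWx; have [a ax Va] := ofilt_way_below Vx.
  exists [set U : F | ofilt_set U a], [set U : F | ~ ofilt_set U a]; split.
  - exact: (open_nbhs_nbhs (conj (open_mem a) Va)).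
  - exact: nbhs_not_mem nWx ax.
  - by apply/seteqP; split=> // U [].
move=> V W VW; apply: ofilt_inj; apply: contrapT => neq.
have [A [B [VA WB AB0]]] : exists A B : set F, [/\ nbhs V A, nbhs W B & A `&` B = set0].
  have [VW'|] := pselect (ofilt_set V `<=` ofilt_set W).
    have [WV|/existsNP[x /not_implyP[Wx nVx]]] :=
        pselect (ofilt_set W `<=` ofilt_set V).
      by case: neq; apply/seteqP.
    by have [A [B [WA VB AB]]] := sep _ _ _ Wx nVx; exists B, A; rewrite setIC.
  by move=> /existsNP[x /not_implyP[Vx nWx]]; exact: sep Vx nWx.
by have [U] := VW _ _ VA WB; rewrite AB0.
Qed.

(** An ultrafilter [G] converges to the set of [x] having some [a] way below them that lies in
    [G]-almost every filter; passing from [V0] to this set makes it Scott open. If [b] is way below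
    some [y] outside the limit, then [b] is not in [V0], so the set of filters avoiding [b] belongs
    to [G]. *)
Lemma lawson_compact : compact [set: F].
Proof.
rewrite compact_ultra => G UG _.
pose V0 x := G [set W : F | ofilt_set W x].
have V0up x y : V0 x -> (x <= y)%O -> V0 y.
  by move=> + xy; apply: filterS => W /= Wx; exact: ofilt_up xy.
have oV : open_filter [set x | exists2 a, way_below a x & V0 a].
  split.
  - exists \top%O, \top%O => //; apply: filterS filterT => W _; exact: ofilt_top.
  - move=> x y [a ax Va] [b bY Vb]; exists (x `&` y)%O; last by rewrite leIl leIr.
    exists (a `&` b)%O; first exact: wbM.
    by apply: filterS (filterI Va Vb) => W WW; apply/ofilt_meet.
  - split=> [x y [a ax Va] xy|E s dE sE [a as_ Va]].
      by exists a => //; apply: way_below_trans ax xy.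
    have [b ab bs] := way_below_interpolation domK as_.
    have [w Ew bw] := bs E s dE sE (lexx s).
    by exists w; split=> //; exists a => //; apply: way_below_trans ab bw.
exists (to_ofilt oV); split=> // U /nbhs_cellP[x [A [[a ax Va] VA xA]]].
apply: (filterS xA).
have Gx : V0 x by apply: V0up Va _; exact: way_below_le.
elim: A VA {xA} => [_|b A IH VA].
  by apply: filterS Gx => W Wx; split.
have [|y nVy bY] := VA b; first by rewrite mem_head.
have [V0b|Gb] := in_ultra_setVsetC [set W : F | ofilt_set W b] UG.
  by case: nVy; exists b.
apply: filterS (filterI Gb (IH _)) => [W [Wb [Wx WA]]|c cA].
  by split=> // c; rewrite inE => /orP[/eqP ->|/WA].
by apply: VA; rewrite inE cA orbT.
Qed.

End open_filters.

(** * Spread families and closedness of [Pk k] *)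

Section spreads.
Context {d : Order.disp_t} {K : tDistrLatticeType d}.
Local Notation F := (lawson (OFilt K)).
Implicit Types (V W : F) (A B : {fset K}).

Definition spread V B :=
  (forall b, b \in B -> ~ ofilt_set V b) /\
  (forall b c, b \in B -> c \in B -> b != c -> ofilt_set V (b `|` c)%O).

Definition pair_joins (B : seq K) : K :=
  (\meet_(x <- B) \meet_(y <- B | y != x) (x `|` y))%O.

Lemma pair_joins_le (B : seq K) b c : b \in B -> c \in B -> b != c ->
  (pair_joins B <= b `|` c)%O.
Proof.
move=> bB cB bc.
apply: (@le_trans _ _ (\meet_(y <- B | y != b) (b `|` y))%O).
  exact: (meets_inf_seq (fun x => \meet_(y <- B | y != x) (x `|` y))%O bB).
by apply: meets_inf_seq => //; rewrite eq_sym.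
Qed.

Lemma ofilt_pair_joins V B : spread V B -> ofilt_set V (pair_joins B).
Proof.
move=> [_ VB]; rewrite /pair_joins.
have VI x y : ofilt_set V x -> ofilt_set V y -> ofilt_set V (x `&` y)%O.
  by move=> Vx Vy; apply/ofilt_meet.
rewrite big_seq; elim/big_ind : _ => // [|b bB]; first exact: ofilt_top.
rewrite big_seq_cond; elim/big_ind : _ => // [|c /andP[cB cb]].
  exact: ofilt_top.
by apply: VB => //; rewrite eq_sym.
Qed.

(** Each element of [B] lies below one of the at most [k] primes that cut out [V]. Distinct elements
    cannot share a prime, as it would bound their join, which is in [V]. *)
Lemma Pk_spread k V B : Pk k V -> spread V B -> (#|` B| <= k)%N.
Proof.
move=> [A [pA Ak VA]] [VB VBB]; apply: leq_trans Ak.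
have [f fP] : exists f : K -> K, forall b, b \in B -> f b \in A /\ (b <= f b)%O.
  have /choice[f fP] : forall b, exists a, b \in B -> a \in A /\ (b <= a)%O.
    move=> b; have [bB|] := boolP (b \in B); last by exists b.
    have := VB b bB; rewrite VA => /contrapT[a aA ba].
    by exists a.
  by exists f.
have <- : #|` [fset f b | b in B]%fset| = #|` B|.
  apply/card_in_imfset => b c bB cB fbc; apply: contrapT => /eqP bc.
  have := VBB b c bB cB bc; rewrite VA; apply.
  have [fA bf] := fP b bB; have [_ cf] := fP c cB.
  by exists (f b) => //; rewrite leUx bf fbc.
apply: fsubset_leq_card; apply/fsubsetP => _ /imfsetP[b /= bB ->].
by have [] := fP b bB.
Qed.

Context (domK : is_domain K).

(* When [b] belongs to a maximal spread family, [x |` b] and [y |` b] could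
   replace it if the last hypothesis failed. *)
Lemma prime_elt_of_ideal V b : ~ ofilt_set V b ->
    (forall x y, ~ ofilt_set V (x `|` b)%O -> ~ ofilt_set V (y `|` b)%O ->
      ~ ofilt_set V (x `|` y `|` b)%O) ->
  exists2 p, prime_elt p & forall x, (x <= p)%O <-> ~ ofilt_set V (x `|` b)%O.
Proof.
move=> nVb VU; pose I := [set x | ~ ofilt_set V (x `|` b)%O].
have dI : directed I.
  split; first by exists b; rewrite /I /= joinxx.
  by move=> x y Ix Iy; exists (x `|` y)%O; [exact: VU|rewrite leUl leUr].
have [dcpo _] := domK; have [p [ubp lubp]] := dcpo I dI.
(* The supremum stays in the ideal: otherwise Scott openness gives [a] way below [p] and [c] way
   below [b] with join in [V], while [a] lies below a member of [I]. *)
have Ip : I p.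
  move=> Vp; have [_ _ oV] := ofiltP V.
  have [a [c [ap cb Vac]]] := scott_open_join domK oV Vp.
  have [e Ie ae] := ap I p dI (conj ubp lubp) (lexx p).
  by apply: Ie; apply: ofilt_up Vac _; apply: leU2 => //; exact: way_below_le.
have Iple x : (x <= p)%O <-> I x.
  split=> [xp|]; last exact: ubp.
  by move=> Vx; apply: Ip; apply: ofilt_up Vx _; exact: leU2.
exists p => //; split.
  by move=> p1; apply: Ip; rewrite p1 join1x; exact: ofilt_top.
left; split.
- exists \top%O => /= /Iple; apply; rewrite join1x; exact: ofilt_top.
- move=> x y nx ny; exists (x `&` y)%O; last by rewrite leIl leIr.
  (* Distributivity makes [p] prime: joining with [b] commutes with meets. *)
  move=> /Iple; apply; rewrite joinIl; apply/ofilt_meet.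
  by split; apply: contrapT => ?; [apply: nx|apply: ny]; apply/Iple.
- by move=> x y nx xy yp; apply: nx; exact: le_trans yp.
Qed.

Lemma spread_Pk k V : (forall B, spread V B -> #|` B| <> k.+1) -> Pk k V.
Proof.
move=> nk.
pose P n := (n <= k)%N && `[< exists2 B, spread V B & #|` B| = n >].
have exP : exists n, P n.
  exists 0%N; apply/andP; split=> //; apply/asboolP; exists fset0; last exact: cardfs0.
  by split=> b; rewrite in_fset0.
have [n /andP[nk' /asboolP[B sB Bn]] maxn] := ex_maxnP exP (fun n h => proj1 (andP h)).
(* [n] is maximal only among sizes at most [k]; for [n = k] the size [k.+1] is excluded by [nk]. *)
have {}maxn B' : spread V B' -> #|` B'| <> n.+1.
  move=> sB' B'n; move: nk'; rewrite leq_eqVlt => /orP[/eqP nk'|nk'].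
    by apply: (nk B' sB'); rewrite B'n nk'.
  have : P n.+1 by apply/andP; split=> //; apply/asboolP; exists B'.
  by move=> /maxn; rewrite ltnn.
have [VB VBB] := sB.
have /choice[p pP] : forall b, exists p, b \in B ->
    prime_elt p /\ forall x, (x <= p)%O <-> ~ ofilt_set V (x `|` b)%O.
  move=> b; have [bB|_] := boolP (b \in B); last by exists b.
  have [|p pp pI] := @prime_elt_of_ideal V b (VB b bB); last by exists p.
  move=> x y nx ny Vxy.
  have notB z : ~ ofilt_set V (z `|` b)%O -> (z `|` b)%O \notin (B `\ b)%fset.
    move=> nz; apply/negP; rewrite !inE => /andP[zb zB]; apply: nz.
    by have := VBB _ _ zB bB zb; rewrite -joinA joinxx.
  have xyb : (x `|` b != y `|` b)%O.
    apply/eqP => xy; apply: nx; rewrite -(joinxx (x `|` b)%O) {2}xy.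
    by rewrite joinACA joinxx.
  have VB' c z : c \in (B `\ b)%fset -> ofilt_set V (c `|` (z `|` b))%O.
    rewrite !inE => /andP[cb cB]; apply: ofilt_up (VBB _ _ cB bB cb) _.
    by apply: leU2 => //; exact: leUr.
  (* Replacing [b] by its joins with [x] and with [y] would give a spread family with one more
     element. *)
  apply: (maxn ((x `|` b)%O |` ((y `|` b)%O |` (B `\ b)))%fset).
    split=> [c|c e].
      rewrite !inE => /orP[/eqP -> //|/orP[/eqP -> //|/andP[_]]]; exact: VB.
    rewrite in_fset1U => /orP[/eqP ->|]; rewrite in_fset1U.
      move=> /orP[/eqP ->|]; first by rewrite eqxx.
      rewrite in_fset1U => /orP[/eqP -> _|eB _]; first by rewrite joinACA joinxx.
      by rewrite joinC; exact: VB'.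
    move=> /orP[/eqP ->|cB]; rewrite in_fset1U => /orP[/eqP ->|].
    - by move=> _; rewrite joinACA joinxx (joinC y).
    - rewrite in_fset1U => /orP[/eqP ->|eB _]; first by rewrite eqxx.
      by rewrite joinC; exact: VB'.
    - by move=> _; exact: VB'.
    - rewrite in_fset1U => /orP[/eqP -> _|]; first exact: VB'.
      move: cB; rewrite !inE => /andP[_ cB] /andP[_ eB]; exact: VBB.
  rewrite cardfsU1 in_fset1U negb_or xyb notB// cardfsU1 notB//.
  by rewrite -Bn (cardfsD1 b B) bB.
exists [fset p b | b in B]%fset; split.
- by move=> _ /imfsetP[b /= bB ->]; have [] := pP b bB.
- by apply: leq_trans nk'; rewrite -Bn; exact: leq_imfset_card.
- apply/seteqP; split=> x.
    move=> Vx [_ /imfsetP[b /= bB ->]]; have [_ ->] := pP b bB; apply.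
    by apply: ofilt_up Vx _; exact: leUl.
  (* An [x] outside [V] and below none of the primes [p b] could be added to [B]. *)
  move=> nx; apply: contrapT => nVx.
  have Vxb b : b \in B -> ofilt_set V (x `|` b)%O.
    move=> bB; apply: contrapT => nVxb; apply: nx; exists (p b).
      by apply/imfsetP; exists b.
    by have [_ ->] := pP b bB.
  have xB : x \notin B by apply/negP => /Vxb; rewrite joinxx.
  apply: (maxn (x |` B)%fset); last by rewrite cardfsU1 xB Bn.
  split=> [c|c e]; first by rewrite !inE => /orP[/eqP ->|/VB].
  rewrite !inE => /orP[/eqP ->|cB] /orP[/eqP ->|eB]; last exact: VBB.
  - by rewrite eqxx.
  - by move=> _; exact: Vxb.
  - by move=> _; rewrite joinC; exact: Vxb.
Qed.

Lemma way_below_join (a b x : K) :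
  way_below a x -> way_below b x -> way_below (a `|` b)%O x.
Proof.
move=> ax bx; have [_ dom] := domK; have [[_ dx] low _] := dom x.
by have [z zx [az bz]] := dx _ _ ax bx; apply: (low _ z) => //; rewrite leUx az.
Qed.

(** [spread_Pk] provides a spread family of [k.+1] elements. As its finitely many joins lie in the
    Scott open [V], each member can be lowered to one way below it without losing them, which turns
    avoidance into the open condition [away]. *)
Lemma not_Pk_away k V : ~ Pk k V ->
  exists B, [/\ #|` B| = k.+1, away B V & ofilt_set V (pair_joins B)].
Proof.
move=> nPk.
have [B sB Bk] : exists2 B, spread V B & #|` B| = k.+1.
  apply: contrapT => H; apply: nPk; apply: spread_Pk => B sB Bk.
  by apply: H; exists B.
have [VB VBB] := sB; have [_ _ oV] := ofiltP V.
have [f fB fV] : exists2 f : K -> K, (forall b, way_below (f b) b) &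
    forall b c, b \in B -> c \in B -> b != c -> ofilt_set V (f b `|` f c)%O.
  (* The pairs are treated one at a time. [f] only increases along the induction, so joins already
     in [V] stay there. *)
  suff : forall r : seq (K * K),
      (forall q, q \in r -> [/\ q.1 \in B, q.2 \in B & q.1 != q.2]) ->
      exists2 f : K -> K, (forall b, way_below (f b) b) &
        forall q, q \in r -> ofilt_set V (f q.1 `|` f q.2)%O.
    move=> /(_ [seq q <- [seq (b, c) | b <- B, c <- B] | q.1 != q.2])[].
      by move=> q; rewrite mem_filter => /andP[qq /allpairsP[[b c] [/= bB cB qE]]];
         move: qq; rewrite qE /= => qq; split.
    move=> f fB fV; exists f => // b c bB cB bc; apply: (fV (b, c)).
    by rewrite mem_filter /= bc /=; apply/allpairsP; exists (b, c).
  elim=> [_|[b c] r IH rB].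
    have /choice[f fP] : forall b : K, exists a, way_below a b.
      by move=> b; have [_ /(_ b)[[[a ab] _] _ _]] := domK; exists a.
    by exists f.
  have [|f fB fV] := IH; first by move=> q qr; apply: rB; rewrite inE qr orbT.
  have [|/= bB cB bc] := rB (b, c); first by rewrite mem_head.
  have [a [a' [ab a'c Vaa]]] := scott_open_join domK oV (VBB b c bB cB bc).
  pose g x := if x == b then (f b `|` a)%O else
              if x == c then (f c `|` a')%O else f x.
  have fg x : (f x <= g x)%O.
    by rewrite /g; case: eqP => [->|_]; [rewrite leUl|case: eqP => [->|//]; rewrite leUl].
  exists g => [x|q].
    by rewrite /g; case: eqP => [->|_]; [exact: way_below_join|];
       case: eqP => [->|//]; exact: way_below_join.
  rewrite inE => /orP[/eqP -> /=|/fV Vq].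
    apply: ofilt_up Vaa _; rewrite /g eqxx (eq_sym c) (negPf bc) eqxx.
    by apply: leU2; exact: leUr.
  by apply: ofilt_up Vq _; exact: leU2.
exists [fset f b | b in B]%fset; split.
- rewrite -Bk; apply/card_in_imfset => b c bB cB fbc.
  apply: contrapT => /eqP bc; apply: (VB b bB).
  apply: ofilt_up (fV b c bB cB bc) _; rewrite -fbc joinxx.
  exact: way_below_le.
- by move=> _ /imfsetP[b /= bB ->]; exists b; [exact: VB|exact: fB].
- apply: ofilt_pair_joins; split.
    move=> _ /imfsetP[b /= bB ->] Vf; apply: (VB b bB).
    by apply: ofilt_up Vf _; exact: way_below_le.
  move=> _ _ /imfsetP[b /= bB ->] /imfsetP[c /= cB ->] fbc; apply: fV => //.
  by apply: contra_neq fbc => ->.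
Qed.

Context (top_way_below : way_below (\top%O : K) \top%O)
  (wbM : way_below_multiplicative K).

(** An element interpolated between [a] and its witness [y] is avoided by all nearby filters, hence
    is a witness for [a] in each of them. *)
Lemma nbhs_away V w (A : seq K) : ofilt_set V w -> away A V ->
  nbhs V [set W : F | ofilt_set W w /\ away A W].
Proof.
move=> Vw VA.
have /choice[h hP] : forall a, exists z, a \in A ->
    way_below a z /\ exists2 y, ~ ofilt_set V y & way_below z y.
  move=> a; have [aA|_] := boolP (a \in A); last by exists a.
  have [y nVy ay] := VA a aA.
  have [z az zy] := way_below_interpolation domK ay.
  by exists z => _; split=> //; exists y.
have VhA : away (map h A) V.
  by move=> _ /mapP[a aA ->]; have [] := hP a aA.
apply: filterS (nbhs_cell domK top_way_below wbM Vw VhA) => W [Ww WA].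
split=> // a aA; exists (h a); last by have [] := hP a aA.
by apply: WA; exact: map_f.
Qed.

(** The conditions of [not_Pk_away] persist nearby by [nbhs_away] and yield a spread family of
    [k.+1] elements, which no member of [Pk k] admits. *)
Lemma closed_Pk k : closed (Pk k : set F).
Proof.
move=> V clV; apply: contrapT => /not_Pk_away[B [Bk VB Vw]].
have [W [PkW [Ww WB]]] := clV _ (nbhs_away Vw VB).
have := @Pk_spread k W B PkW; rewrite Bk ltnn => H; apply/(elimF idP erefl)/H.
split=> [b /WB[y nWy by_] Wb|b c bB cB bc].
  by apply: nWy; apply: ofilt_up Wb _; exact: way_below_le.
by apply: ofilt_up Ww _; exact: pair_joins_le.
Qed.

End spreads.

(** * Finite approximations and their limit *)

Section nablas.
Context {d : Order.disp_t} {K : latticeType d} {R : realType}.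
Local Open Scope ring_scope.
Implicit Types (Phi Psi : K -> R) (x z p q : K) (s t : seq K).

Lemma nablaC x z Psi : nabla x (nabla z Psi) = nabla z (nabla x Psi).
Proof.
apply: (@eq_nablas _ _ _ [:: z; x] [:: x; z]) => y.
by rewrite !inE orbC.
Qed.

Lemma nablaxx x Psi : nabla x (nabla x Psi) = nabla x Psi.
Proof.
apply: (@eq_nablas _ _ _ [:: x; x] [:: x]) => y.
by rewrite !inE orbb.
Qed.

Lemma nablasN s Psi : nablas s (fun q => - Psi q) = (fun q => - nablas s Psi q).
Proof.
elim: s Psi => // z s IH Psi /=; rewrite -IH; congr nablas.
by apply/funext => q; rewrite /nabla opprB opprK addrC.
Qed.

Lemma nablas_constB c s Psi : s != [::] ->
  nablas s (fun q => c - Psi q) = (fun q => - nablas s Psi q).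
Proof.
case: s => // z s _ /=; rewrite -nablasN; congr nablas.
by apply/funext => q; rewrite /nabla /= !opprB addrC addrA subrK.
Qed.

Lemma nablas_vanish s Psi x : (forall q, (q <= x)%O -> Psi q = 0) ->
  forall q, (q <= x)%O -> nablas s Psi q = 0.
Proof.
elim: s Psi => // z s IH Psi Psi0; apply: IH => q qx.
by rewrite /nabla !Psi0 ?subrr// (le_trans (leIl _ _)).
Qed.

Lemma nabla_vanish z Psi q : (q <= z)%O -> nabla z Psi q = 0.
Proof. by move=> qz; rewrite /nabla (meet_idPl qz) subrr. Qed.

Lemma completely_alternating_seq Phi s q :
  completely_alternating Phi -> s != [::] -> nablas s Phi q <= 0.
Proof.
move=> [_ CA] s0; rewrite (@eq_nablas _ _ _ s [fset x in s]%fset).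
  apply: CA; case: s s0 => // z s _; apply/fset0Pn; exists z.
  by rewrite in_fset mem_head.
by move=> y; rewrite in_fset.
Qed.

(* Splitting along the entries of [s] writes [Psi p] as a sum over the subsets
   [A] of [s] of the terms [nablas A Psi] at the meet of [p] and the entries
   outside [A].  Each term is a mass placed at that meet. *)
Fixpoint weight Psi p s (E : set K) : R :=
  if s is z :: s' then
    weight Psi (p `&` z)%O s' E + weight (nabla z Psi) p s' E
  else Psi p *+ `[< E p >].

Lemma weight_setT Psi p s : weight Psi p s setT = Psi p.
Proof.
elim: s Psi p => /= [|z s IH] Psi p; first by rewrite asboolT.
by rewrite !IH addrC subrK.
Qed.

Lemma weightU Psi p s A B : A `&` B = set0 ->
  weight Psi p s (A `|` B) = weight Psi p s A + weight Psi p s B.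
Proof.
move=> AB0; elim: s Psi p => /= [|z s IH] Psi p; last by rewrite !IH addrACA.
rewrite -mulrnDr; congr (_ *+ _).
have [Ap|nA] := pselect (A p).
  rewrite asboolT; last by left.
  by rewrite asboolT// asboolF// => Bp; have : set0 p by rewrite -AB0.
rewrite (asboolF nA); have [Bp|nB] := pselect (B p).
  by rewrite asboolT; [rewrite asboolT|right].
by rewrite !asboolF// => -[].
Qed.

(** One term is [Psi] at the meet of [p] and all entries of [s]; every other term is a [nablas]
    along a nonempty list. *)
Lemma weight_ge0 Psi p s E :
    (forall t, t != [::] -> forall q, 0 <= nablas t Psi q) ->
    0 <= Psi (foldl Order.meet p s) ->
  0 <= weight Psi p s E.
Proof.
elim: s Psi p => /= [|z s IH] Psi p Psi_ge0 Psip; first exact: mulrn_wge0.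
apply: addr_ge0; first exact: IH.
apply: IH => [t t0 q|]; first exact: (Psi_ge0 (z :: t)).
exact: (Psi_ge0 [:: z]).
Qed.

Lemma eq_weight Psi p s A B : (forall q, (q <= p)%O -> A q <-> B q) ->
  weight Psi p s A = weight Psi p s B.
Proof.
elim: s Psi p => /= [|z s IH] Psi p AB.
  by rewrite (asbool_equiv_eq (AB p (lexx p))).
rewrite (IH _ (p `&` z)%O) ?(IH _ p)// => q qp; apply: AB.
exact: le_trans qp (leIl _ _).
Qed.

Lemma weight_vanish Psi x p s E : (forall q, (q <= x)%O -> Psi q = 0) ->
  weight Psi p s (E `&` [set q | (q <= x)%O]) = 0.
Proof.
elim: s Psi p => /= [|z s IH] Psi p Psi0.
  have [[_ /= px]|nE] := pselect ((E `&` [set q | (q <= x)%O]) p).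
    by rewrite Psi0// mul0rn.
  by rewrite asboolF.
rewrite !IH ?addr0//.
by move=> q; exact: (@nablas_vanish [:: z]).
Qed.

Lemma weight_below Psi p s x E : (p <= x)%O ->
  weight Psi p s (E `&` [set q | (q <= x)%O]) = weight Psi p s E.
Proof.
move=> px; apply: eq_weight => q qp; split=> [[]//|Eq]; split=> //=.
exact: le_trans px.
Qed.

Lemma weight_above Psi p s x E : (p <= x)%O ->
  weight Psi p s (E `&` [set q | ~ (q <= x)%O]) = 0.
Proof.
move=> px; rewrite -[RHS](@weight_vanish (fun=> 0) x p s set0)//.
transitivity (weight Psi p s set0); last first.
  rewrite set0I; elim: s Psi p {px} => /= [|z s IH] Psi p.
    by rewrite asboolF// !mulr0n.
  by rewrite !IH; congr (_ + weight _ _ _ _); apply/funext => q; rewrite /nabla subrr.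
apply: eq_weight => q qp; split=> [[_ /=]|//]; apply.
exact: le_trans px.
Qed.

Lemma weight_nabla_below Psi p s z E : (p <= z)%O -> weight (nabla z Psi) p s E = 0.
Proof.
move=> pz; rewrite -(weight_below _ _ _ pz) weight_vanish// => q.
exact: nabla_vanish.
Qed.

(** When [x] itself is split, the first branch has all its points below [x], and the second carries
    [nabla x Psi], which vanishes below [x]. Splitting along other entries commutes with the
    restriction. *)
Lemma weight_le Psi p s x E : x \in s ->
  weight Psi p s (E `&` [set q | (q <= x)%O]) = weight Psi (p `&` x)%O s E.
Proof.
elim: s Psi p => //= z s IH Psi p; rewrite inE => /orP[/eqP <-{z}|xs].
  rewrite weight_below ?leIr// weight_vanish; last by move=> q; exact: nabla_vanish.
  by rewrite -meetA meetxx weight_nabla_below// leIr.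
by rewrite !IH// meetAC.
Qed.

Lemma weight_nle Psi p s x E : x \in s ->
  weight Psi p s (E `&` [set q | ~ (q <= x)%O]) = weight (nabla x Psi) p s E.
Proof.
elim: s Psi p => //= z s IH Psi p; rewrite inE => /orP[/eqP <-{z}|xs].
  rewrite weight_above ?leIr// nablaxx (@weight_nabla_below _ (p `&` x)%O) ?leIr//.
  congr (_ + _).
  transitivity (weight (nabla x Psi) p s ((E `&` [set q | ~ (q <= x)%O]) `|`
      (E `&` [set q | (q <= x)%O]))).
    rewrite weightU ?weight_vanish ?addr0// => [q|]; first exact: nabla_vanish.
    by apply/seteqP; split=> // q [[_ nqx] [_ qx]].
  congr weight; rewrite -setIUr -[RHS]setIT; congr (_ `&` _).
  by apply/seteqP; split=> // q _; have [qx|nqx] := pselect (q <= x)%O; [right|left].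
by rewrite !IH// nablaC.
Qed.

Lemma weight_nles Psi p s t E : {subset t <= s} ->
  weight Psi p s (E `&` [set q | forall a, a \in t -> ~ (q <= a)%O]) =
  weight (nablas t Psi) p s E.
Proof.
elim: t Psi => [|a t IH] Psi ts /=.
  congr weight; rewrite -[RHS]setIT; congr (_ `&` _).
  by apply/seteqP; split=> q.
rewrite -IH; last by move=> b bt; apply: ts; rewrite inE bt orbT.
rewrite -(weight_nle _ _ _ (ts a (mem_head a t))); congr weight.
rewrite -setIA; congr (_ `&` _); apply/seteqP; split=> q.
  by move=> qt; split=> [b bt|]; apply: qt; rewrite ?mem_head// inE bt orbT.
by move=> [qt qa] b; rewrite inE => /orP[/eqP ->|/qt].
Qed.

(** Discarding the points below entries of [t] applies [nablas t], restricting to those below [x]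
    moves the start to the meet of [p] and [x], and a total mass remains. *)
Lemma weight_cell Psi p s t x : {subset t <= s} -> x \in s ->
  weight Psi p s [set q | (q <= x)%O /\ forall a, a \in t -> ~ (q <= a)%O] =
  nablas t Psi (p `&` x)%O.
Proof.
move=> ts xs; have -> : [set q | (q <= x)%O /\ forall a, a \in t -> ~ (q <= a)%O] =
    (setT `&` [set q | (q <= x)%O]) `&` [set q | forall a, a \in t -> ~ (q <= a)%O].
  by rewrite setTI.
by rewrite weight_nles// weight_le// weight_setT.
Qed.

End nablas.

Lemma ultra_bounded_cvg {R : realType} {T : Type} (G : set_system T) (f : T -> R)
    (M : R) : UltraFilter G -> (\forall t \near G, 0 <= f t <= M)%R ->
  cvg (f @ G).
Proof.
move=> UG fM; have cM : compact `[0%R, M]%classic by exact: segment_compact.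
have [|l [_ cl]] := cM (f @ G) _.
  by near=> t; rewrite /= in_itv /=; near: t.
apply/cvg_ex; exists l => A Al; have [//|GA] := in_ultra_setVsetC (f @^-1` A) UG.
by have [y [nAy Ay]] := cl (~` A) A GA Al.
Unshelve. all: by end_near. Qed.

(** * A finitely additive limit of the approximations *)

Section limit_content.
Context {d : Order.disp_t} {K : tLatticeType d} {R : realType}.
Local Notation F := (lawson (OFilt K)).
Local Open Scope ring_scope.
Implicit Types (E A B : set F) (x z w : K) (s : seq K).

Definition avoid x : set F := [set V | ~ ofilt_set V x].

Context (domK : is_domain K) (top_way_below : way_below (\top%O : K) \top%O)
  (wbM : way_below_multiplicative K).
Context (Phi : K -> R) (Phi1 : Phi \top%O = 0)
  (Phi_CA : completely_alternating Phi).

Let upF := up_ofilt domK top_way_below wbM.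

(* The additive constant, which leaves all [nabla]s unchanged, makes the mass at
   the meet of all the entries of [s] vanish instead of being nonpositive. *)
Definition approx s E : R :=
  weight (fun q => Phi (foldl Order.meet \top%O s) - Phi q) \top%O s [set p | E (upF p)].

Let approx_ge0 s E : 0 <= approx s E.
Proof.
apply: weight_ge0 => [t t0 q|]; last by rewrite subrr.
by rewrite nablas_constB// oppr_ge0 completely_alternating_seq.
Qed.

Let approxU s A B : A `&` B = set0 -> approx s (A `|` B) = approx s A + approx s B.
Proof.
move=> AB0; rewrite /approx -weightU//.
by apply/seteqP; split=> // p [Ap Bp]; rewrite -[set0 p]/(set0 (upF p)) -AB0.
Qed.

Let weight_mono Psi s (A B : set K) :
    (forall t, t != [::] -> forall q, 0 <= nablas t Psi q) ->
    0 <= Psi (foldl Order.meet \top%O s) -> A `<=` B ->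
  weight Psi \top%O s A <= weight Psi \top%O s B :> R.
Proof.
move=> P0 P1 AB; have -> : B = A `|` (B `\` A).
  apply/seteqP; split=> p; last by case=> [/AB|[]].
  by move=> Bp; have [Ap|nA] := pselect (A p); [left|right].
rewrite weightU ?lerDl ?weight_ge0//.
by apply/seteqP; split=> // p [Ap []].
Qed.

Let approx_le s E (A : set K) : [set p | E (upF p)] `<=` A ->
  approx s E <= weight (fun q => Phi (foldl Order.meet \top%O s) - Phi q) \top%O s A.
Proof.
apply: weight_mono; last by rewrite subrr.
by move=> t t0 q; rewrite nablas_constB// oppr_ge0 completely_alternating_seq.
Qed.

Let approx_mono s A B : A `<=` B -> approx s A <= approx s B.
Proof. by move=> AB; apply: approx_le => p; exact: AB. Qed.

Let approx_avoid_le s x z : way_below z x -> z \in s -> \top%O \in s ->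
  approx s (avoid x) <= Phi z.
Proof.
move=> zx zs ts.
(* By [weight_cell], [Phi z] is the mass of the points not below [z]: the additive constant cancels
   and [Phi] vanishes at the top. *)
have -> : Phi z = weight (fun q => Phi (foldl Order.meet \top%O s) - Phi q) \top%O s
    [set q | (q <= \top)%O /\ forall a, a \in [:: z] -> ~ (q <= a)%O].
  rewrite weight_cell//; last by move=> a; rewrite inE => /eqP ->.
  by rewrite /= /nabla !meet1x Phi1 subr0 opprB addrC subrK.
apply: approx_le => p /= npx; split=> [|a]; first exact: lex1.
rewrite inE => /eqP -> pz; apply: npx; rewrite up_ofiltE.
exact: way_below_trans pz zx (lexx x).
Qed.

Let approx_avoid_ge s x : x \in s -> \top%O \in s -> Phi x <= approx s (avoid x).
Proof.
move=> xs ts.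
have -> : Phi x = weight (fun q => Phi (foldl Order.meet \top%O s) - Phi q) \top%O s
    [set q | (q <= \top)%O /\ forall a, a \in [:: x] -> ~ (q <= a)%O].
  rewrite weight_cell//; last by move=> a; rewrite inE => /eqP ->.
  by rewrite /= /nabla !meet1x Phi1 subr0 opprB addrC subrK.
apply: weight_mono; last first.
- move=> q /= [_ /(_ x (mem_head _ _)) nqx] qx; apply: nqx.
  exact: (way_below_le qx).
- by rewrite subrr.
- by move=> t t0 q; rewrite nablas_constB// oppr_ge0 completely_alternating_seq.
Qed.

(** If [up p] contains [w] and satisfies [away B], then [p] is below [w] and below no element of
    [B]. The points of this kind have total mass minus [nablas B Phi w], which is zero. *)
Let approx_away s (B : {fset K}) w : w \in s -> {subset B <= s} -> B != fset0 ->
  nablas B Phi w = 0 -> approx s [set W | ofilt_set W w /\ away B W] = 0.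
Proof.
move=> ws Bs B0 Bw; apply/eqP; rewrite eq_le approx_ge0 andbT.
have B0' : (B : seq K) != [::].
  by apply: contra B0 => /eqP B0; rewrite -cardfs_eq0 B0.
have := @weight_cell _ _ _ (fun q => Phi (foldl Order.meet \top%O s) - Phi q)
  \top%O s B w Bs ws.
rewrite nablas_constB// meet1x Bw oppr0 => <-; apply: approx_le => p /= [].
rewrite up_ofiltE => /way_below_le pw pB; split=> // b bB pb.
have [y npy by_] := pB b bB; apply: npy; rewrite up_ofiltE.
exact: way_below_trans pb by_ (lexx y).
Qed.

Lemma limit_content : exists m : set F -> R, [/\
  forall E x, E `<=` avoid x -> 0 <= m E,
  forall A B x, A `<=` avoid x -> B `<=` avoid x -> A `&` B = set0 ->
    m (A `|` B) = m A + m B,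
  forall x z, way_below z x -> m (avoid x) <= Phi z,
  forall x, Phi x <= m (avoid x) &
  forall (B : {fset K}) w, B != fset0 -> nablas B Phi w = 0 ->
    m [set W | ofilt_set W w /\ away B W] = 0].
Proof.
(* Tails of the finite lists under inclusion: each given element is eventually in the list. *)
pose G0 := filter_from [set: seq K] (fun s => [set t : seq K | {subset s <= t}]).
have G0F : ProperFilter G0.
  apply: filter_from_proper => [|s _]; last by exists s => /=.
  apply: filter_from_filter; first by exists [::].
  move=> s t _ _; exists (s ++ t) => // r /= str.
  by split=> a ar; apply: str; rewrite mem_cat ar ?orbT.
have [G [UG G0G]] := ultraFilterLemma G0F.
have Gs s : \forall t \near G, {subset s <= (t : seq K)} by apply: G0G; exists s.
have Gx x : \forall t \near G, x \in (t : seq K).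
  near=> t; have /(_ x) : {subset [:: x] <= t} by near: t; exact: Gs.
  by apply; rewrite mem_head.
(* The bound by [avoid x] keeps the values between 0 and [Phi z], for some [z] way below [x]. As
   [Phi] may be unbounded, the total masses may be unbounded too. *)
have cv E x : E `<=` avoid x -> cvg ((approx^~ E) @ G).
  move=> Ex; have [_ /(_ x)[[[z zx] _] _ _]] := domK.
  apply: (@ultra_bounded_cvg _ _ _ _ (Phi z)).
  near=> t; rewrite approx_ge0/=; apply: le_trans (approx_mono t Ex) _.
  by apply: approx_avoid_le => //; near: t; exact: Gx.
exists (fun E => lim ((approx^~ E) @ G)); split.
- move=> E x Ex; apply: limr_ge; first exact: cv Ex.
  by near=> t; exact: approx_ge0.
- move=> A B x Ax Bx AB0; apply/cvg_lim => //.
  under eq_fun do rewrite approxU//.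
  by apply: cvgD; [exact: (cv A x)|exact: (cv B x)].
- move=> x z zx; apply: limr_le; first exact: (cv _ x).
  by near=> t; apply: approx_avoid_le => //; near: t; exact: Gx.
- move=> x; apply: limr_ge; first exact: (cv _ x).
  by near=> t; apply: approx_avoid_ge => //; near: t; exact: Gx.
- move=> B w B0 Bw; apply/cvg_lim => //; apply: cvg_near_cst.
  near=> t; apply: approx_away => //; near: t; first exact: Gx.
  exact: Gs.
Unshelve. all: by end_near. Qed.

End limit_content.

(** * The measure on [Pk'] *)

Section subspace.
Context {T : topologicalType} (D : set T).
Local Notation val := (@set_val T D).
Implicit Types (A : set (set_type D)).

Lemma set_val_inj : injective val.
Proof. by move=> x y; rewrite !set_valE => /val_inj. Qed.

Lemma set_val_continuous : continuous val.
Proof. exact: initial_continuous. Qed.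

Lemma nbhs_set_valP x A :
  nbhs x A <-> exists2 B, nbhs (val x) B & val @^-1` B `<=` A.
Proof.
split=> [xA|[B xB]]; last first.
  by move=> BA; apply: filterS BA _; exact: (set_val_continuous xB).
rewrite nbhsE in xA; case: xA => _ [[B oB <-] Bx] BA; exists B => //.
exact: open_nbhs_nbhs.
Qed.

Lemma set_type_hausdorff : hausdorff_space T -> hausdorff_space (set_type D).
Proof.
move=> hT x y xy; apply: set_val_inj; apply: hT => A B xA yB.
have [z [Az Bz]] := xy _ _ (set_val_continuous xA) (set_val_continuous yB).
by exists (val z).
Qed.

Lemma compact_set_val A : compact A -> compact (val @` A).
Proof.
move=> cA; apply: continuous_compact => //.
by apply: continuous_subspaceT; exact: set_val_continuous.
Qed.

Lemma compact_preimage_set_val (C : set T) : compact C -> C `<=` D ->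
  compact (val @^-1` C).
Proof.
move=> cC CD G FG GC.
have [y [Cy Gy]] := cC (val @ G) _ GC.
pose x : set_type D := exist (fun y => y \in D) y (mem_set (CD _ Cy)).
exists x; split=> // A B GA /nbhs_set_valP[B' xB' B'B].
have GA' : G (val @^-1` (val @` A)) by apply: filterS GA => z Az; exists z.
have [_ [[z Az <-] B'z]] := Gy (val @` A) B' GA' xB'.
by exists z; split=> //; exact: B'B.
Qed.

End subspace.

Section Pk_space.
Context {d : Order.disp_t} {K : tDistrLatticeType d} (k : nat).
Context (domK : is_domain K) (top_way_below : way_below (\top%O : K) \top%O)
  (wbM : way_below_multiplicative K).
Local Notation F := (lawson (OFilt K)).
Local Notation X := (Pk' K k).
Local Notation val := (@set_val F (Pk k `\` [set V : F | ofilt_set V = setT])).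
Implicit Types (x y z : K) (V : X).

Lemma avoid_meet x y : avoid (x `&` y)%O = avoid x `|` avoid y :> set F.
Proof.
apply/seteqP; split=> V /=.
  move=> nVxy; have [Vx|nVx] := pselect (ofilt_set V x); last by left.
  by right => Vy; apply: nVxy; apply/ofilt_meet.
by move=> [nV|nV] /ofilt_meet[].
Qed.

Lemma closed_avoid x : closed (avoid x : set F).
Proof. by apply: open_closedC; exact: open_mem. Qed.

Lemma avoid_interior x y : way_below x y -> (avoid y : set F) `<=` (avoid x)°.
Proof. by move=> xy V nVy; exact: nbhs_not_mem xy. Qed.

Lemma Pk'_Pk V : Pk k (val V).
Proof. by have [] := set_valP V. Qed.

Lemma Pk'_avoid V : exists y, avoid y (val V).
Proof.
have [_ nT] := set_valP V; apply: contrapT => H; apply: nT.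
by apply/seteqP; split=> // y _; apply: contrapT => nVy; apply: H; exists y.
Qed.

Lemma image_Pk_avoid x : val @` (@Pk_avoid _ K k x) = avoid x `&` Pk k.
Proof.
apply/seteqP; split=> [_ [V Vx <-]|V [nVx PV]]; first by split=> //; exact: Pk'_Pk.
have VD : (Pk k `\` [set V : F | ofilt_set V = setT]) V.
  by split=> //= VT; apply: nVx; rewrite VT.
by exists (exist (fun W : F => W \in _) V (mem_set VD)).
Qed.

Lemma compact_Pk_avoid x : compact (@Pk_avoid _ K k x).
Proof.
have -> : @Pk_avoid _ K k x = val @^-1` (avoid x `&` Pk k).
  by apply/seteqP; split=> [V nVx|V []//]; split=> //; exact: Pk'_Pk.
apply: compact_preimage_set_val; last first.
  by rewrite -image_Pk_avoid => _ [V _ <-]; exact: set_valP.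
apply: (subclosed_compact _ (lawson_compact domK top_way_below wbM)) => //.
by apply: closedI; [exact: closed_avoid|exact: closed_Pk].
Qed.

Lemma hausdorff_Pk' : hausdorff_space X.
Proof. by apply: set_type_hausdorff; exact: lawson_hausdorff. Qed.

Lemma nbhs_Pk_avoid V : exists a, nbhs V (@Pk_avoid _ K k a).
Proof.
have [y nVy] := Pk'_avoid V.
have [_ /(_ y)[[[a ay] _] _ _]] := domK; exists a.
by apply/nbhs_set_valP; exists (avoid a) => //; exact: nbhs_not_mem ay.
Qed.

Lemma locally_compact_Pk' V : exists2 C : set X, compact C & nbhs V C.
Proof.
by have [a Va] := nbhs_Pk_avoid V; exists (Pk_avoid k a) => //; exact: compact_Pk_avoid.
Qed.

(** By [avoid_meet], the finitely many [a] of a cover reduce to their meet. *)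
Lemma compact_avoid_interior (C : set X) : compact C ->
  exists a, val @` C `<=` (avoid a)°.
Proof.
move=> /compact_set_val cC.
have [W [a Wa] CW] : exists2 W : set F, (exists a, W `<=` avoid a) &
    val @` C `<=` W°.
  apply: (compact_cover_ind (P := fun W => exists a, W `<=` avoid a)) => //.
  - by exists \top%O.
  - move=> A B [a Aa] [b Bb]; exists (a `&` b)%O; rewrite avoid_meet.
    exact: setUSS.
  - move=> _ [V _ <-]; have [y nVy] := Pk'_avoid V.
    have [_ /(_ y)[[[a ay] _] _ _]] := domK; exists (avoid a); first by exists a.
    exact: nbhs_not_mem ay.
by exists a => V /CW; apply: filterS.
Qed.

End Pk_space.

(** * A content on the compact subsets of [Pk'] *)

Section Pk_content.
Context {d : Order.disp_t} {K : tDistrLatticeType d} {R : realType} (k : nat).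
Context (domK : is_domain K) (top_way_below : way_below (\top%O : K) \top%O)
  (wbM : way_below_multiplicative K).
Local Notation F := (lawson (OFilt K)).
Local Notation X := (Pk' K k).
Local Notation val := (@set_val F (Pk k `\` [set V : F | ofilt_set V = setT])).
Implicit Types (x y z : K) (E A B : set F) (C D : set X).
Context (Phi : K -> R) (m : set F -> R).
Local Open Scope ereal_scope.
Context (m_ge0 : forall E x, E `<=` avoid x -> (0 <= m E)%R)
  (mU : forall A B x, A `<=` avoid x -> B `<=` avoid x -> A `&` B = set0 ->
    m (A `|` B) = (m A + m B)%R)
  (m_avoid_le : forall x z, way_below z x -> (m (avoid x) <= Phi z)%R)
  (m_avoid_ge : forall x, (Phi x <= m (avoid x))%R)
  (m_away : forall B : {fset K}, #|` B| = k.+1 ->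
    m [set W | ofilt_set W (pair_joins B) /\ away B W] = 0%R).

(* The neighbourhoods are taken in all of [F], because [m] is only finitely
   additive and need not be carried by [Pk k]. *)
Definition Pk_content C : \bar R :=
  ereal_inf [set (m E)%:E | E in
    [set E : set F | (exists x, E `<=` avoid x) /\ val @` C `<=` E°]].

Let m_le A B x : B `<=` avoid x -> A `<=` B -> (m A <= m B)%R.
Proof.
move=> Bx AB; have -> : B = A `|` (B `\` A).
  apply/seteqP; split=> p; last by case=> [/AB|[]].
  by move=> Bp; have [Ap|nA] := pselect (A p); [left|right].
have BAx : B `\` A `<=` avoid x by move=> p [/Bx].
have Ax : A `<=` avoid x by move=> p /AB /Bx.
rewrite (@mU _ _ x)// ?lerDl ?(m_ge0 BAx)//.
by apply/seteqP; split=> // p [Ap []].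
Qed.

Let m_subadd A B x : A `<=` avoid x -> B `<=` avoid x -> (m (A `|` B) <= m A + m B)%R.
Proof.
move=> Ax Bx; have -> : A `|` B = A `|` (B `\` A).
  apply/seteqP; split=> p [Ap|]; [by left| |by left|by case; right].
  by move=> Bp; have [Ap|nA] := pselect (A p); [left|right].
have BAx : B `\` A `<=` avoid x by move=> p [/Bx].
rewrite (@mU _ _ x)//; last by apply/seteqP; split=> // p [Ap []].
by rewrite lerD2l (m_le Bx)// => p [].
Qed.

Let m0 : m set0 = 0%R.
Proof.
have := @mU set0 set0 \top%O (@sub0set _ _) (@sub0set _ _) (setI0 _).
by rewrite setU0 -[LHS]addr0 => /addrI.
Qed.

Let Pk_content_le_m C E x : E `<=` avoid x -> val @` C `<=` E° ->
  Pk_content C <= (m E)%:E.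
Proof. by move=> Ex CE; apply: ereal_inf_lbound; exists E => //; split=> //; exists x. Qed.

Let Pk_content_ge0 C : 0 <= Pk_content C.
Proof.
by apply: le_ereal_inf_tmp => _ [E [[x Ex] _] <-]; rewrite lee_fin (m_ge0 Ex).
Qed.

Let Pk_content_fin C : compact C -> Pk_content C < +oo.
Proof.
move=> /(compact_avoid_interior domK top_way_below wbM)[a Ca].
by apply: le_lt_trans (Pk_content_le_m (@subset_refl _ _) Ca) _; exact: ltry.
Qed.

Let Pk_content_fin_num C : compact C -> Pk_content C \is a fin_num.
Proof. by move=> /Pk_content_fin; rewrite ge0_fin_numE. Qed.

Let Pk_content0 : Pk_content set0 = 0.
Proof.
apply/eqP; rewrite eq_le Pk_content_ge0 andbT.
have := @Pk_content_le_m set0 set0 \top%O (@sub0set _ _).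
by rewrite m0; apply; rewrite image_set0.
Qed.

Let Pk_content_le C D : C `<=` D -> Pk_content C <= Pk_content D.
Proof.
move=> CD; apply: ereal_inf_le_tmp => _ [E [Ex DE] <-]; exists E => //.
by split=> //; apply: subset_trans DE; exact: image_subset.
Qed.

Let Pk_contentU C D : compact C -> compact D ->
  Pk_content (C `|` D) <= Pk_content C + Pk_content D.
Proof.
move=> cC cD; rewrite -leeBlDr ?Pk_content_fin_num//.
apply: le_ereal_inf_tmp => _ [A [[x Ax] CA] <-].
rewrite leeBlDr ?Pk_content_fin_num// -leeBlDl//.
apply: le_ereal_inf_tmp => _ [B [[y By] DB] <-].
rewrite leeBlDl//.
have Axy : A `<=` avoid (x `&` y)%O.
  by rewrite avoid_meet => V /Ax; left.
have Bxy : B `<=` avoid (x `&` y)%O.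
  by rewrite avoid_meet => V /By; right.
apply: (@le_trans _ _ (m (A `|` B))%:E); last by rewrite -EFinD lee_fin (m_subadd Axy).
apply: (@Pk_content_le_m _ _ (x `&` y)%O); first by rewrite subUset.
rewrite image_setU => V [/CA|/DB]; apply: filterS; first exact: subsetUl.
exact: subsetUr.
Qed.

(** Disjoint open neighbourhoods in [F] of the two images cut any neighbourhood [E] of their union
    into disjoint neighbourhoods of each. *)
Let Pk_content_disjoint C D : compact C -> compact D -> C `&` D = set0 ->
  Pk_content C + Pk_content D <= Pk_content (C `|` D).
Proof.
move=> cC cD CD0; apply: le_ereal_inf_tmp => _ [E [[x Ex] CDE] <-].
have hF := lawson_hausdorff domK top_way_below wbM.
have [|A [B [oA oB CA DB AB0]]] :=
    compact_separate hF (compact_set_val cC) (compact_set_val cD).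
  apply/seteqP; split=> // _ [[V CV <-] [W DW /set_val_inj WV]].
  by rewrite -[set0 _]/(set0 V) -CD0; split; rewrite // -WV.
have EAx : E `&` A `<=` avoid x by move=> V [/Ex].
have EBx : E `&` B `<=` avoid x by move=> V [/Ex].
apply: (@le_trans _ _ (m (E `&` A) + m (E `&` B))%:E).
  rewrite EFinD; apply: leeD.
    apply: (Pk_content_le_m EAx) => V CV; apply: filterI.
      by apply: CDE; rewrite image_setU; left.
    by apply: open_nbhs_nbhs; split=> //; exact: CA.
  apply: (Pk_content_le_m EBx) => V DV; apply: filterI.
    by apply: CDE; rewrite image_setU; right.
  by apply: open_nbhs_nbhs; split=> //; exact: DB.
rewrite lee_fin -(mU EAx EBx); last by rewrite setIACA AB0 setI0.
by apply: (m_le Ex) => V [[]|[]].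
Qed.

Let Pk_content_avoid_le x z : way_below z x -> Pk_content (Pk_avoid k x) <= (Phi z)%:E.
Proof.
move=> zx; have [a za ax] := way_below_interpolation domK zx.
apply: (@le_trans _ _ (m (avoid a))%:E); last by rewrite lee_fin m_avoid_le.
apply: (@Pk_content_le_m _ _ a) => // _ [V nVx <-].
exact: (avoid_interior domK top_way_below wbM ax).
Qed.

(** What the interior of a neighbourhood [E] leaves of [avoid x] is compact and off [Pk k], hence is
    covered by finitely many [m]-null neighbourhoods; so [m E] is at least [m (avoid x)]. *)
Let Pk_content_avoid_ge x : (Phi x)%:E <= Pk_content (Pk_avoid k x).
Proof.
apply: le_ereal_inf_tmp => _ [E [[y Ey] xE] <-].
rewrite lee_fin; apply: le_trans (m_avoid_ge x) _.
have cxE : compact (avoid x `\` E°).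
  apply: (subclosed_compact _ (lawson_compact domK top_way_below wbM)) => //.
  apply: closedI; first exact: closed_avoid.
  by apply: open_closedC; exact: open_interior.
have [W W0 xEW] : exists2 W : set F, m (W `&` avoid x) = 0%R & avoid x `\` E° `<=` W°.
  apply: (compact_cover_ind (P := fun W => m (W `&` avoid x) = 0%R)) => //.
  - by rewrite set0I.
  - move=> A B A0 B0; have := @m_subadd (A `&` avoid x) (B `&` avoid x) x
      (@subIsetr _ _ _) (@subIsetr _ _ _).
    rewrite A0 B0 addr0 -setIUl => AB0; apply/eqP; rewrite eq_le AB0/=.
    exact: m_ge0 (@subIsetr _ _ _).
  - move=> V [nVx nEV].
    have [B [Bk VB Vw]] : exists B : {fset K}, [/\ #|` B| = k.+1, away B V &
        ofilt_set V (pair_joins B)].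
      apply: not_Pk_away => // PV; apply: nEV.
      have [W Wx <-] : (val @` (@Pk_avoid _ K k x)) V.
        by rewrite image_Pk_avoid.
      by apply: xE; exists W.
    exists [set W | ofilt_set W (pair_joins B) /\ away B W]; last exact: nbhs_away.
    (* [B] is nonempty, so the set lies in some [avoid b], where [m] is monotone. *)
    have [b bB] : exists b, b \in B by apply/fset0Pn; rewrite -cardfs_eq0 Bk.
    have Wb : [set W : F | ofilt_set W (pair_joins B) /\ away B W] `<=` avoid b.
      move=> W [_ /(_ b bB)[z nWz bz]] Wb; apply: nWz.
      by apply: ofilt_up Wb _; exact: way_below_le.
    apply/eqP; rewrite eq_le -{1}(m_away Bk) (m_le Wb)/=; last by move=> ? [].
    by apply: (m_ge0 (x := x)) => ? [].
have Exy : E `|` (W `&` avoid x) `<=` avoid (x `&` y)%O.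
  by rewrite avoid_meet => V [/Ey|[]]; [right|left].
apply: (@le_trans _ _ (m (E `|` (W `&` avoid x)))).
  apply: (m_le Exy) => V nVx; have [EV|nEV] := pselect (E° V).
    by left; exact: interior_subset EV.
  by right; split=> //; apply: interior_subset; apply: xEW.
move: Exy; rewrite subUset => -[Exy Wxy].
by apply: le_trans (m_subadd Exy Wxy) _; rewrite W0 addr0.
Qed.

Lemma radon_Pk_content : radon_measure (outer_content Pk_content).
Proof.
apply: (outer_content_radon (hausdorff_Pk' domK top_way_below wbM)) => //.
- by move=> C D _ _; exact: Pk_content_le.
- by move=> V; exact: locally_compact_Pk'.
Qed.

Lemma outer_Pk_content_avoid_ge x : (Phi x)%:E <= outer_content Pk_content (Pk_avoid k x).
Proof.
apply: le_trans (Pk_content_avoid_ge x) _; apply: outer_content_ge.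
exact: compact_Pk_avoid.
Qed.

Lemma outer_Pk_content_avoid_le x z : way_below z x ->
  outer_content Pk_content (Pk_avoid k x) <= (Phi z)%:E.
Proof.
move=> zx; have [a za ax] := way_below_interpolation domK zx.
apply: (@le_trans _ _ (inner_content Pk_content (Pk_avoid k a)°)).
  apply: ereal_inf_lbound; exists (Pk_avoid k a)° => //; split.
    exact: open_interior.
  move=> V nVx; apply/nbhs_set_valP; exists (avoid a) => //.
  exact: (avoid_interior domK top_way_below wbM ax).
apply: ge_ereal_sup => _ [C [_ /subset_trans/(_ (@interior_subset _ _)) CA] <-].
exact: le_trans (Pk_content_le CA) (Pk_content_avoid_le za).
Qed.

End Pk_content.

(** * Necessity and uniqueness *)

Section borel_measures.
Context {R : realType} {T : topologicalType}.
Implicit Types (A B : set T).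
Local Open Scope ereal_scope.

Lemma borel_sigma_algebra : sigma_algebra [set: T] (@borel T).
Proof. exact: smallest_sigma_algebra. Qed.

Lemma borel_open A : open A -> borel A.
Proof. by move=> oA; apply: sub_sigma_algebra. Qed.

Lemma borelC A : borel A -> borel (~` A).
Proof.
by move=> bA; have [_ + _] := borel_sigma_algebra => /(_ A bA); rewrite setTD.
Qed.

Lemma borel0 : borel (@set0 T).
Proof. by apply: borel_open; exact: open0. Qed.

Lemma borelU A B : borel A -> borel B -> borel (A `|` B).
Proof.
move=> bA bB; rewrite -bigcup2E; have [_ _ bU] := borel_sigma_algebra.
by apply: bU => -[//|[//|n]]; exact: borel0.
Qed.

Lemma borelI A B : borel A -> borel B -> borel (A `&` B).
Proof.
move=> bA bB; rewrite -(setCK (A `&` B)) setCI.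
by apply: borelC; apply: borelU; exact: borelC.
Qed.

Lemma borelD A B : borel A -> borel B -> borel (A `\` B).
Proof. by move=> bA bB; rewrite setDE; apply: borelI => //; exact: borelC. Qed.

Lemma borel_closed A : closed A -> borel A.
Proof.
move=> cA; rewrite -(setCK A); apply: borelC; apply: borel_open.
exact: closed_openC.
Qed.

Context (mu : set T -> \bar R) (bmu : borel_measure mu).

Lemma borel_measureU A B : borel A -> borel B -> A `&` B = set0 ->
  mu (A `|` B) = mu A + mu B.
Proof.
move=> bA bB AB0; have [mu0 mu_ge0 mu_add] := bmu.
have b2 n : borel (bigcup2 A B n) by case: n => [//|[//|n]]; exact: borel0.
rewrite -bigcup2E mu_add//; last by rewrite -trivIset_bigcup2.
rewrite (nneseries_split _ 2); last by move=> n _; exact: mu_ge0.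
rewrite eseries0 ?adde0; last by move=> [|[|n]].
by rewrite add0n big_nat_recr//= big_nat1.
Qed.

Lemma borel_measureD A B : borel A -> borel B -> B `<=` A ->
  mu A = mu B + mu (A `\` B).
Proof.
move=> bA bB BA; rewrite -borel_measureU//; first by rewrite setDUK.
- exact: borelD.
- by apply/seteqP; split=> // x [Bx []].
Qed.

Lemma le_borel_measure A B : borel A -> borel B -> A `<=` B -> mu A <= mu B.
Proof.
move=> bA bB AB; rewrite (borel_measureD bB bA AB) leeDl//.
by have [_ + _] := bmu; apply; exact: borelD.
Qed.

End borel_measures.

Section cell_measure.
Context {d : Order.disp_t} {K : tDistrLatticeType d} {R : realType} (k : nat).
Context (domK : is_domain K) (top_way_below : way_below (\top%O : K) \top%O)
  (wbM : way_below_multiplicative K).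
Local Notation F := (lawson (OFilt K)).
Local Notation X := (Pk' K k).
Local Notation val := (@set_val F (Pk k `\` [set V : F | ofilt_set V = setT])).
Local Open Scope ereal_scope.

Definition Pk_cell (x : K) (A : seq K) : set X := val @^-1` cell x A.

Lemma borel_Pk_avoid x : borel (@Pk_avoid _ K k x).
Proof.
apply: borel_closed; apply: compact_closed.
  exact: (hausdorff_Pk' domK top_way_below wbM).
exact: (compact_Pk_avoid domK top_way_below wbM).
Qed.

Lemma Pk_cell_cons x a A : Pk_cell x (a :: A) = Pk_cell x A `&` Pk_avoid k a.
Proof.
apply/seteqP; split=> V.
  move=> [Vx VA]; split; last by apply: VA; exact: mem_head.
  by split=> // b bA; apply: VA; rewrite inE bA orbT.
move=> [[Vx VA] nVa]; split=> // b; rewrite inE => /orP[/eqP ->//|]; exact: VA.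
Qed.

Lemma Pk_cell_nil x : Pk_cell x [::] = ~` Pk_avoid k x.
Proof.
apply/seteqP; split=> V; first by move=> [Vx _].
by move=> nV; split=> //; exact: contrapT.
Qed.

Lemma borel_Pk_cell x A : borel (Pk_cell x A).
Proof.
elim: A => [|a A IH].
  by rewrite Pk_cell_nil; apply: borelC; exact: borel_Pk_avoid.
by rewrite Pk_cell_cons; apply: borelI => //; exact: borel_Pk_avoid.
Qed.

Context (Phi : K -> R) (mu : set X -> \bar R) (bmu : borel_measure mu)
  (muE : forall x, (Phi x)%:E = mu (Pk_avoid k x)).

(** Induction on [A]: removing the cell at the meet of [x] and [a] from the cell at [x] leaves the
    filters that also avoid [a]. As [A] is nonempty, the measures are finite and can be
    subtracted. *)
Lemma mu_Pk_cell x A : A != [::] -> mu (Pk_cell x A) = (- nablas A Phi x)%:E.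
Proof.
elim: A x => // a [|b A] IH x _.
  rewrite /= /nabla opprB EFinB !muE.
  rewrite [mu (Pk_avoid k (x `&` a)%O)](borel_measureD bmu (B := Pk_avoid k x)).
  - rewrite addeAC -muE subee// add0e Pk_cell_cons Pk_cell_nil; congr mu.
    apply/seteqP; split=> V [].
      by move=> /contrapT Vx nVa; split=> [/ofilt_meet[]//|/(_ Vx)].
    move=> nVxa /contrapT Vx; split; first by move=> /(_ Vx).
    by move=> Va; apply: nVxa; apply/ofilt_meet.
  - exact: borel_Pk_avoid.
  - exact: borel_Pk_avoid.
  - by move=> V nVx /ofilt_meet[].
(* [nablas] applies its first entry innermost; moving [a] to the end makes [nabla a] the outermost
   operation. *)
rewrite (@eq_nablas _ _ _ _ (rcons (b :: A) a)); last first.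
  by move=> c; rewrite mem_rcons.
rewrite /nablas foldl_rcons -/(nablas (b :: A) Phi) /nabla opprB EFinB.
have muN y : (nablas (b :: A) Phi y)%:E = - mu (Pk_cell y (b :: A)).
  by rewrite IH// EFinN oppeK.
rewrite !muN oppeK addeC.
rewrite [mu (Pk_cell x (b :: A))](borel_measureD bmu
  (B := Pk_cell (x `&` a)%O (b :: A))).
- rewrite addeAC subee ?add0e; last by rewrite IH.
  congr mu; rewrite Pk_cell_cons; apply/seteqP; split=> V.
    by move=> [[Vx VA] nVa]; split=> // -[/ofilt_meet[]].
  move=> [[Vx VA] nV]; split=> // Va; apply: nV; split=> //.
  by apply/ofilt_meet.
- exact: borel_Pk_cell.
- exact: borel_Pk_cell.
- by move=> V [/ofilt_meet[Vx Va] VA].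
Qed.

Lemma measure_completely_alternating : completely_alternating Phi.
Proof.
split=> [x y xy|A A0 x].
  rewrite -lee_fin !muE; apply: (le_borel_measure bmu).
  - exact: borel_Pk_avoid.
  - exact: borel_Pk_avoid.
  - by move=> V nVy Vx; apply: nVy; exact: ofilt_up xy.
have A0' : (A : seq K) != [::].
  by apply: contra A0 => /eqP A0; rewrite -cardfs_eq0 A0.
rewrite -oppr_ge0 -lee_fin -mu_Pk_cell//.
by have [_ + _] := bmu; apply; exact: borel_Pk_cell.
Qed.

(** The corresponding cell is empty: for its members, which lie in [Pk k], the family [B] would be
    spread. *)
Lemma measure_nablas_pair_joins (B : {fset K}) : #|` B| = k.+1 ->
  nablas B Phi (pair_joins B) = 0%R.
Proof.
move=> Bk; have B0 : (B : seq K) != [::] by rewrite -size_eq0 Bk.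
have := mu_Pk_cell (pair_joins B) B0.
have -> : Pk_cell (pair_joins B) B = set0.
  apply/seteqP; split=> // V [Vw VB]; have := @Pk_spread _ _ k _ B (Pk'_Pk V).
  rewrite Bk ltnn => H; apply/(elimF idP erefl)/H; split=> // b c bB cB bc.
  by apply: ofilt_up Vw _; exact: pair_joins_le.
by have [-> _ _] := bmu => /eqP; rewrite eq_sym eqe oppr_eq0 => /eqP.
Qed.

(** Outer regularity gives an open [U] around [Pk_avoid k x] of measure below [Phi x + e]. Each
    point of [Pk_avoid k z0] outside [U] contains [x], hence some [z] way below [x]. By compactness
    and directedness one [z] serves all these points, and for an upper bound [c] of [z] and [z0] way
    below [x] the set [Pk_avoid k c] lies in [U]. *)
Lemma measure_conjugate : (forall x, 0 <= Phi x)%R -> Phi \top%O = 0%R ->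
    (forall B : set X, borel B ->
      mu B = ereal_inf [set mu U | U in [set U | open U /\ B `<=` U]]) ->
  is_conjugate Phi.
Proof.
move=> Phi_ge0 Phi1 outer; split=> // x.
have [[[z0 z0x] dx] _ _] := domK.2 x.
have lbx : lbound [set Phi z | z in [set z | way_below z x]] (Phi x).
  move=> _ [z /= zx <-]; have [mono _] := measure_completely_alternating.
  by apply: mono; exact: way_below_le.
apply/eqP; rewrite eq_le; apply/andP; split.
  by apply: lb_le_inf => //; exists (Phi z0), z0.
apply/ler_addgt0Pr => e e0.
have : ereal_inf [set mu U | U in [set U | open U /\ Pk_avoid k x `<=` U]] <
    (Phi x + e)%:E.
  by rewrite -outer; [rewrite -muE lte_fin ltrDl|exact: borel_Pk_avoid].
move=> /ereal_inf_lt[_ [U [oU xU] <-] Ue].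
have cC : compact (Pk_avoid k z0 `\` U : set X).
  apply: (@subclosed_compact _ _ (Pk_avoid k z0)) => //.
    apply: closedI; last exact: open_closedC.
    apply: compact_closed; first exact: (hausdorff_Pk' domK top_way_below wbM).
    exact: (compact_Pk_avoid domK top_way_below wbM).
  exact: (compact_Pk_avoid domK top_way_below wbM).
have [W [z zx Wz] CW] : exists2 W : set X,
    (exists2 z, way_below z x & W `&` Pk_avoid k z = set0) &
    Pk_avoid k z0 `\` U `<=` W°.
  apply: (compact_cover_ind (P := fun W => exists2 z,
    way_below z x & W `&` Pk_avoid k z = set0)) => //.
  - by exists z0 => //; rewrite set0I.
  - move=> A B [a ax Aa] [b bx Bb]; have [c cx [ac bc]] := dx _ _ ax bx.
    exists c => //; apply/seteqP; split=> // V [[AV|BV] nVc].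
      by rewrite -Aa; split=> // Va; apply: nVc; exact: ofilt_up ac.
    by rewrite -Bb; split=> // Vb; apply: nVc; exact: ofilt_up bc.
  - move=> V [nVz0 nUV].
    have Vx : ofilt_set (val V) x by apply: contrapT => nVx; apply/nUV/xU.
    have [z zx Vz] := ofilt_way_below domK Vx.
    exists (val @^-1` [set V : F | ofilt_set V z]).
      by exists z => //; apply/seteqP; split=> // W [].
    apply/nbhs_set_valP; exists [set V : F | ofilt_set V z] => //.
    by apply: open_nbhs_nbhs; split=> //; exact: open_mem.
have [c cx [z0c zc]] := dx _ _ z0x zx.
apply: (@le_trans _ _ (Phi c)).
  by apply: ge_inf; [exists (Phi x)|exists c].
rewrite -lee_fin muE; apply: le_trans (ltW Ue).
apply: (le_borel_measure bmu); [exact: borel_Pk_avoid|exact: borel_open|].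
move=> V nVc; apply: contrapT => nUV.
suff : set0 V by [].
rewrite -Wz; split; last by move=> Vz; apply: nVc; exact: ofilt_up zc.
apply: interior_subset; apply: CW; split=> //.
by move=> Vz0; apply: nVc; exact: ofilt_up z0c.
Qed.

End cell_measure.

(** * Uniqueness through finite unions of cells *)

Section uniqueness.
Context {d : Order.disp_t} {K : tDistrLatticeType d} {R : realType} (k : nat).
Context (domK : is_domain K) (top_way_below : way_below (\top%O : K) \top%O)
  (wbM : way_below_multiplicative K).
Local Notation F := (lawson (OFilt K)).
Local Notation X := (Pk' K k).
Local Notation val := (@set_val F (Pk k `\` [set V : F | ofilt_set V = setT])).
Local Open Scope ereal_scope.

Definition Pk_cells (r : seq (K * seq K)) : set X :=
  [set V | exists2 q, q \in r & Pk_cell q.1 q.2 V].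

(** The cells that avoid at least one element are those whose measure [mu_Pk_cell] computes from
    [Phi]. *)
Let solid (r : seq (K * seq K)) := forall q, q \in r -> q.2 != [::].

Lemma Pk_cells_cons q r : Pk_cells (q :: r) = Pk_cell q.1 q.2 `|` Pk_cells r.
Proof.
apply/seteqP; split=> V.
  by move=> [p]; rewrite inE => /orP[/eqP -> Vq|pr Vp]; [left|right; exists p].
move=> [Vq|[p pr Vp]]; first by exists q => //; exact: mem_head.
by exists p => //; rewrite inE pr orbT.
Qed.

Lemma borel_Pk_cells r : borel (Pk_cells r).
Proof.
elim: r => [|q r IH]; last first.
  by rewrite Pk_cells_cons; apply: borelU => //; exact: borel_Pk_cell.
rewrite (_ : Pk_cells _ = set0); first exact: borel0.
by apply/seteqP; split=> // V [].
Qed.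

Lemma Pk_cellI_cells q r : Pk_cells r `&` Pk_cell q.1 q.2 =
  Pk_cells [seq ((p.1 `&` q.1)%O, p.2 ++ q.2) | p <- r].
Proof.
apply/seteqP; split=> V.
  move=> [[p pr Vp] Vq]; exists ((p.1 `&` q.1)%O, p.2 ++ q.2); first exact: map_f.
  by rewrite /Pk_cell /= -cellI.
move=> [_ /mapP[p pr ->]]; rewrite /Pk_cell /= -cellI => -[Vp Vq].
by split=> //; exists p.
Qed.

Lemma Pk_cells_between (C U : set X) : compact C -> open U -> C `<=` U ->
  exists r, [/\ solid r, C `<=` Pk_cells r & Pk_cells r `<=` U].
Proof.
move=> cC oU CU.
have [W [r [sr WE WU]] CW] : exists2 W : set X,
    (exists r, [/\ solid r, W = Pk_cells r & W `<=` U]) & C `<=` W°.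
  apply: (compact_cover_ind (P := fun W => exists r,
      [/\ solid r, W = Pk_cells r & W `<=` U])) => //.
  - by exists [::]; split=> //; apply/seteqP; split=> // V [].
  - move=> A B [r [sr AE AU]] [s [ss BE BU]]; exists (r ++ s); split.
    + by move=> q; rewrite mem_cat => /orP[/sr|/ss].
    + rewrite AE BE; apply/seteqP; split=> V.
        by move=> [[q qr Vq]|[q qr Vq]]; exists q; rewrite // mem_cat qr ?orbT.
      move=> [q]; rewrite mem_cat => /orP[qr|qs] Vq; [left|right]; by exists q.
    + by rewrite subUset.
  - move=> V CV; have : nbhs V U by apply: open_nbhs_nbhs; split=> //; exact: CU.
    move=> /nbhs_set_valP[B /(nbhs_cellP domK top_way_below wbM)].
    move=> [x [A [Vx VA AB]]] BU.
    (* Points of [Pk'] differ from [K], so an avoided [a] can be added to the cell to make it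
       solid. *)
    have [y nVy] := Pk'_avoid V.
    have [_ /(_ y)[[[a ay] _] _ _]] := domK.
    exists (Pk_cell x (a :: A)).
      exists [:: (x, a :: A)]; split.
      + by move=> q; rewrite inE => /eqP ->.
      + apply/seteqP; split=> W; first by exists (x, a :: A); rewrite ?mem_head.
        by move=> [q]; rewrite inE => /eqP ->.
      + by rewrite Pk_cell_cons => W [/AB/BU].
    apply/nbhs_set_valP; exists (cell x (a :: A)) => //.
    apply: (nbhs_cell domK top_way_below wbM) => // b.
    by rewrite inE => /orP[/eqP ->|/VA//]; exists y.
exists r; split=> //; last by rewrite -WE.
by rewrite -WE => V /CW; exact: interior_subset.
Qed.

Context (Phi : K -> R).

(** With a cell [q] split off, the rest [r] loses its intersection with [q], which is again a union
    of as many solid cells as [r] has. Hence the induction is on the number of cells, not on the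
    list. *)
Lemma eq_mu_Pk_cells (mu nu : set X -> \bar R) r :
    borel_measure mu -> (forall x, (Phi x)%:E = mu (Pk_avoid k x)) ->
    borel_measure nu -> (forall x, (Phi x)%:E = nu (Pk_avoid k x)) ->
  solid r -> mu (Pk_cells r) = nu (Pk_cells r).
Proof.
move=> bmu muE bnu nuE; move: {2}(size r) (erefl (size r)) => n.
elim: n r => [|n IH] [|q r]//= => [_|[rn]] sr.
  have -> : Pk_cells [::] = set0 by apply/seteqP; split=> // V [p].
  by have [-> _ _] := bmu; have [-> _ _] := bnu.
have sr' : solid r by move=> p pr; apply: sr; rewrite inE pr orbT.
have q0 : q.2 != [::] by apply: sr; exact: mem_head.
have bq : borel (Pk_cell q.1 q.2 : set X) by exact: borel_Pk_cell.
have br := borel_Pk_cells r.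
have UE : Pk_cells (q :: r) = Pk_cell q.1 q.2 `|` (Pk_cells r `\` Pk_cell q.1 q.2).
  rewrite Pk_cells_cons; apply/seteqP; split=> V [Vq|Vr]; [by left| |by left|].
    by have [Vq|nVq] := pselect (Pk_cell q.1 q.2 V); [left|right].
  by right; case: Vr.
have I0 : Pk_cell q.1 q.2 `&` (Pk_cells r `\` Pk_cell q.1 q.2) = set0.
  by apply/seteqP; split=> // V [Vq []].
have diffE (la : set X -> \bar R) : borel_measure la ->
    (forall x, (Phi x)%:E = la (Pk_avoid k x)) ->
    la (Pk_cells r `\` Pk_cell q.1 q.2) =
      la (Pk_cells r) - la (Pk_cells r `&` Pk_cell q.1 q.2).
  move=> bla laE.
  have bI : borel (Pk_cells r `&` Pk_cell q.1 q.2) by exact: borelI.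
  have la_ge0 : 0 <= la (Pk_cells r `&` Pk_cell q.1 q.2).
    by have [_ + _] := bla; apply.
  have fin : la (Pk_cells r `&` Pk_cell q.1 q.2) \is a fin_num.
    rewrite ge0_fin_numE//; apply: (@le_lt_trans _ _ (la (Pk_cell q.1 q.2))).
      exact: (le_borel_measure bla).
    by rewrite (mu_Pk_cell domK top_way_below wbM bla laE)// ltry.
  rewrite [la (Pk_cells r)](borel_measureD bla br bI); last by move=> V [].
  rewrite addeAC subee// add0e; congr la.
  by apply/seteqP; split=> V [rV nq]; split=> //; [move=> []|move=> qV; apply: nq].
rewrite UE borel_measureU//; last exact: borelD.
rewrite [RHS]borel_measureU//; last exact: borelD.
rewrite (diffE mu)// (diffE nu)// Pk_cellI_cells.
rewrite !(mu_Pk_cell domK top_way_below wbM (Phi := Phi))//.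
rewrite (IH r)// (IH [seq _ | p <- r]) ?size_map//.
move=> _ /mapP[p pr ->] /=.
by rewrite -size_eq0 size_cat addn_eq0 !size_eq0 (negPf (sr' p pr)).
Qed.

(** Unions of solid cells between a compact set and its open neighbourhoods give agreement on
    compact sets, by outer regularity. Inner regularity carries it to open sets, and outer
    regularity to Borel sets. *)
Lemma radon_measure_unique (mu nu : set X -> \bar R) :
    radon_measure mu -> (forall x, (Phi x)%:E = mu (Pk_avoid k x)) ->
    radon_measure nu -> (forall x, (Phi x)%:E = nu (Pk_avoid k x)) ->
  forall B, borel B -> mu B = nu B.
Proof.
have hX := hausdorff_Pk' domK top_way_below wbM (k := k).
have le_compact (mu' nu' : set X -> \bar R) : radon_measure mu' ->
    (forall x, (Phi x)%:E = mu' (Pk_avoid k x)) ->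
    radon_measure nu' -> (forall x, (Phi x)%:E = nu' (Pk_avoid k x)) ->
    forall C, compact C -> mu' C <= nu' C.
  move=> [bmu _ _ _] muE [bnu _ _ nu_outer] nuE C cC.
  have bC : borel C by apply: borel_closed; exact: compact_closed.
  rewrite nu_outer//; apply: le_ereal_inf_tmp => _ [U [oU CU] <-].
  have [r [sr Cr rU]] := Pk_cells_between cC oU CU.
  have br := borel_Pk_cells r.
  apply: (le_trans (le_borel_measure bmu bC br Cr)).
  rewrite (eq_mu_Pk_cells bmu muE bnu nuE sr).
  exact: (le_borel_measure bnu br (borel_open oU)).
move=> Rmu muE Rnu nuE.
have eqC C : compact C -> mu C = nu C.
  move=> cC; apply/eqP; rewrite eq_le.
  by rewrite (le_compact _ _ Rmu muE Rnu nuE)// (le_compact _ _ Rnu nuE Rmu muE).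
have [_ _ mu_inner mu_outer] := Rmu; have [_ _ nu_inner nu_outer] := Rnu.
have eqU U : open U -> mu U = nu U.
  move=> oU; rewrite mu_inner// nu_inner//; congr ereal_sup.
  by apply/seteqP; split=> _ [C [cC CU] <-]; exists C => //; rewrite eqC.
move=> B bB; rewrite mu_outer// nu_outer//; congr ereal_inf.
by apply/seteqP; split=> _ [U [oU BU] <-]; exists U => //; rewrite eqU.
Qed.

End uniqueness.

Theorem theorem7p14 (d : Order.disp_t) (K : tDistrLatticeType d) (R : realType)
    (k : nat) (Phi : K -> R) :
  is_domain K ->
  way_below (\top%O : K) \top%O ->
  way_below_multiplicative K ->
  (1 <= k)%N ->
  (forall x : K, 0 <= Phi x)%R ->
  Phi \top%O = 0%R ->
  ((exists lambda : set (Pk' K k) -> \bar R,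
      [/\ radon_measure lambda,
          (forall x : K, (Phi x)%:E = lambda (Pk_avoid k x)) &
          forall mu : set (Pk' K k) -> \bar R,
            radon_measure mu ->
            (forall x : K, (Phi x)%:E = mu (Pk_avoid k x)) ->
            forall B : set (Pk' K k), borel B -> mu B = lambda B])
   <-> conjugate_valuation k Phi).
Proof.
move=> domK top_way_below wbM _ Phi_ge0 Phi1; split.
  move=> [la [[bla _ _ la_outer] laE _]]; split.
  - exact: (measure_conjugate domK top_way_below wbM bla laE).
  - exact: (measure_completely_alternating domK top_way_below wbM bla laE).
  - exact: (measure_nablas_pair_joins domK top_way_below wbM bla laE).
move=> [[_ Phi_inf _] Phi_CA Phi_k].
have [m [m_ge0 mU m_le m_ge m0]] := limit_content domK top_way_below wbM Phi1 Phi_CA.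
have m_away (B : {fset K}) : #|` B| = k.+1 ->
    m [set W | ofilt_set W (pair_joins B) /\ away B W] = 0%R.
  by move=> Bk; apply: m0; [rewrite -cardfs_eq0 Bk|exact: Phi_k].
have radon := radon_Pk_content k domK top_way_below wbM m_ge0 mU.
have laE x : (Phi x)%:E = outer_content (Pk_content m) (Pk_avoid k x).
  have := outer_Pk_content_avoid_ge domK top_way_below wbM m_ge0 mU m_ge m_away x.
  have := @outer_Pk_content_avoid_le _ _ _ k domK top_way_below wbM Phi m m_le x.
  (* A finite value is squeezed between [Phi x] and all [Phi z] with [z] way below [x], whose
     infimum is [Phi x]; any such [z] rules out [+oo]. *)
  case: (outer_content _ _) => [r| |] //= le ge.
  - congr EFin; apply/eqP; rewrite eq_le -lee_fin ge andTb Phi_inf.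
    have [[[z zx] _] _ _] := domK.2 x.
    apply: lb_le_inf; first by exists (Phi z), z.
    by move=> _ [y /le + <-]; rewrite lee_fin.
  - by have [[[z zx] _] _ _] := domK.2 x; have := le z zx.
exists (outer_content (Pk_content m)); split=> // mu Rmu muE.
exact: (radon_measure_unique domK top_way_below wbM Rmu muE radon laE).
Qed.
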